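(* Let $\mathbb{A}=[A_{i,j}]_{1\le i\le p,\,1\le j\le q}$ be a block matrix all of whose blocks $A_{i,j}$ are normal $n\times n$ complex matrices, and let $f:[0,\infty)\to[0,\infty)$ be concave and e-convex. Then, for every symmetric norm $\|\cdot\|$, $$ \left\|\,f(|\mathbb{A}|)\,\right\|\le\left\|\,\sum_{i,j} f(|A_{i,j}|)\,\right\|. $$
   Context: For a complex matrix $X$, $|X|=(X^*X)^{1/2}$. For a positive semi-definite $P$, $f(P)$ is defined by the functional calculus. A function $f$ on $[0,\infty)$ is called e-convex if $t\mapsto f(e^t)$ is convex on $(-\infty,\infty)$. A symmetric (or unitarily invariant) norm is a norm on complex matrices satisfying $\|X\|=\|UXV\|$ for all $X$ and all unitaries $U,V$. Here the left side involves a $qn\times qn$ matrix and the right side an $n\times n$ matrix; the symmetric norm is a norm on the $qn\times qn$ matrices, and an $n\times n$ matrix $Y$ is identified with $\begin{pmatrix}Y&0\\0&0\end{pmatrix}$ (padding with zeros) when its norm is taken. *)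

(* Defs.v *)
From mathcomp Require Import all_boot all_order all_algebra.
From mathcomp Require Import classical_sets set_interval reals topology.
From mathcomp Require Import convex sequences exp.
From mathcomp Require Import complex.

Set Implicit Arguments.
Unset Strict Implicit.
Unset Printing Implicit Defensive.

Import Order.TTheory GRing.Theory Num.Theory.

Local Open Scope classical_set_scope.
Local Open Scope ring_scope.
Local Open Scope complex_scope.
Local Open Scope sesquilinear_scope.

Definition concave_nneg (R : realType) (f : R -> R) : Prop :=
  @convex_function R R^o `[0, +oo[ (fun x : R => - f x).

Definition e_convex (R : realType) (f : R -> R) : Prop :=
  @convex_function R R^o setT (fun t : R => f (expR t)).

(* The result is meaningful when P is Hermitian (in particular positive
   semi-definite): spectralmx P is then unitary, spectral_diag P is real, and
   P = invmx (spectralmx P) *m diag_mx (spectral_diag P) *m spectralmx P.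
   By mxfunE below, any other unitary diagonalization gives the same value. *)
Definition mxfun (R : realType) (f : R -> R) (m : nat) (P : 'M[R[i]]_m) :
    'M[R[i]]_m :=
  invmx (spectralmx P)
    *m diag_mx (map_mx (fun z : R[i] => (f (complex.Re z))%:C) (spectral_diag P))
    *m spectralmx P.

Definition absmx (R : realType) (m n : nat) (X : 'M[R[i]]_(m, n)) :
    'M[R[i]]_n :=
  mxfun Num.sqrt (X ^t* *m X).

Record symmetric_norm (R : realType) (m : nat) (N : 'M[R[i]]_m -> R) : Prop :=
  SymmetricNorm {
    symnorm_ge0 : forall X, 0 <= N X;
    symnorm_eq0 : forall X, N X = 0 -> X = 0;
    symnormZ : forall (a : R[i]) X, (N (a *: X))%:C = `|a| * (N X)%:C;
    symnormD : forall X Y, N (X + Y) <= N X + N Y;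
    symnorm_unitary : forall U V X : 'M[R[i]]_m,
      U \is unitarymx -> V \is unitarymx -> N (U *m X *m V) = N X
  }.

(* Zero padding of an n x n matrix to a qn x qn matrix; the size is written as
   the sum that is the number of columns of a block matrix. *)
Definition padmx (R : realType) (q n : nat) (Y : 'M[R[i]]_n) :
    'M[R[i]]_(\sum_(j < q) n) :=
  \mxblock_(i < q, j < q)
    (if (i == 0 :> nat) && (j == 0 :> nat) then Y else 0 : 'M[R[i]]_n).

Lemma mxfunE (R : realType) (f : R -> R) (m : nat) (U : 'M[R[i]]_m)
    (d : 'rV[R]_m) : U \is unitarymx ->
  mxfun f (invmx U *m diag_mx (map_mx (fun x : R => x%:C) d) *m U)
  = invmx U *m diag_mx (map_mx (fun x : R => (f x)%:C) d) *m U.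
Proof.
move=> Uu; set D := diag_mx _; set P := invmx U *m D *m U.
have Uunit := unitarymx_unit Uu; have Vunit := spectral_unit P.
have Pn : P \is normalmx.
  have DtE : D ^t* = D.
    apply/matrixP=> i j; rewrite !mxE rmorphMn /= eq_sym.
    case: eqP => [->|_]; rewrite ?mulr0n // !mulr1n.
    by apply: CrealP; rewrite complex_real.
  have PtE : P ^t* = P.
    rewrite /P invmx_unitary // !trmx_mul !map_mxM /= trmxCK DtE mulmxA.
    by [].
  by apply/normalmxP; rewrite PtE.
have /orthomx_spectralP PE := Pn.
rewrite /mxfun; set V := spectralmx P in PE Vunit *.
set a := spectral_diag P in PE *.
have [W WdefE] : exists W, W = V *m invmx U by eexists.
have WE : diag_mx a *m W = W *m D.
  have VP : V *m P = diag_mx a *m V by rewrite {1}PE -!mulmxA mulKVmx.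
  have PU : P *m invmx U = invmx U *m D by rewrite /P mulmxK.
  by rewrite WdefE mulmxA -VP -[LHS]mulmxA PU mulmxA.
set fa := map_mx _ _; set fd := map_mx _ _.
have fWE : diag_mx fa *m W = W *m diag_mx fd.
  apply/matrixP=> i j; move/matrixP/(_ i j): WE.
  rewrite !mul_diag_mx /D !mul_mx_diag; rewrite !mxE => E.
  have [->|W0] := eqVneq (W i j) 0; first by rewrite mulr0 mul0r.
  by move: E; rewrite mulrC => /(mulfI W0) ->; rewrite mulrC.
have <- : invmx V *m (diag_mx fa *m W) *m U = invmx V *m diag_mx fa *m V.
  by rewrite WdefE !mulmxA mulmxKV.
by rewrite fWE WdefE !mulmxA mulVmx // mul1mx.
Qed.

(* Main.v *)
Require Import Defs.
From mathcomp Require Import all_boot all_order all_algebra all_fingroup.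
From mathcomp Require Import boolp classical_sets interval_inference.
From mathcomp Require Import reals convex sequences exp complex.
From mathcomp Require Import ring lra zify.

(* Write each normal block as A_ij = sum_l z_ijl b_ijl^* b_ijl in an orthonormal
   eigenbasis.  Indexing all these terms by t, the block matrix is the sum of
   rank-one terms z_t x_t^* y_t, where x_t and y_t are b_t placed in block i,
   resp. j.  Put R = sum |z_t| x_t^* x_t and C = sum |z_t| y_t^* y_t; these are
   the block diagonal matrices with blocks sum_j |A_ij|, resp. sum_i |A_ij|.

   1. (Horn)  By Cauchy-Binet and Cauchy-Schwarz for determinants, the product of
   the squares of the m largest singular values of the block matrix is at most
   the product of the m largest eigenvalues of R and of C.  For g e-convex and
   nondecreasing with g(0) = 0, the Tomic-Weyl argument bounds the sum of the g
   of these singular values by the mean of the sums of g over the eigenvalues of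
   R and of C.

   2. (Bourin-Uchiyama)  If C = sum c_t y_t^* y_t with unit vectors y_t has
   eigenvectors u_k and eigenvalues d_k, then c_t sum_k |<u_k, y_t>|^2 / d_k <= 1.
   Hence, g being concave, the sum of g(d_k) over k < m is at most
   sum_t g(c_t) sum_(k < m) |<u_k, y_t>|^2.

   3. The same weights show that P -> tr (P - h)_+ is superadditive, which
   replaces the block diagonal matrix sum g(c_t) y_t^* y_t by the n x n matrix
   sum g(c_t) b_t^* b_t = sum_ij g(|A_ij|).

   4. This gives a weak majorization of spectra for g = f - f(0); the constant
   f(0) contributes m f(0) <= min(m, n) p q f(0) for m <= q n.  Transfers
   between diagonal entries turn weak majorization into an inequality of norms. *)

Set Implicit Arguments.
Unset Strict Implicit.
Unset Printing Implicit Defensive.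

Import Order.TTheory GRing.Theory Num.Theory.
Local Open Scope ring_scope.
Local Open Scope complex_scope.
Local Open Scope sesquilinear_scope.

(** * Convexity of real functions *)

(** Denominators are cleared, so that [a = b] is included and later uses are linear in the values of
    [phi]. *)
Lemma convex_function_chord (R : realType) (D : set R) (phi : R -> R) (a x b : R) :
  @convex_function R R^o D phi -> D a -> D b -> a <= x <= b ->
  (b - a) * phi x <= (b - x) * phi a + (x - a) * phi b.
Proof.
move=> cvx Da Db /andP[ax xb].
have [ab|ab] := leP b a.
  have xa : x = a by lra.
  have ba : b = a by lra.
  by rewrite xa ba !subrr !mul0r addr0.
have ba0 : 0 < b - a by lra.
have t0 : 0 <= (b - x) / (b - a) by rewrite divr_ge0 //; lra.
have t1 : (b - x) / (b - a) <= 1 by rewrite ler_pdivrMr //; lra.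
have := cvx (Itv01 t0 t1) a b; rewrite !inE => /(_ Da Db).
rewrite /conv /= /conv /= /GRing.scale /= /unstable.onem.
have -> : (b - x) / (b - a) * a + (1 - (b - x) / (b - a)) * b = x.
  by field; rewrite gt_eqF.
rewrite -(ler_pM2l ba0) => /le_trans; apply.
rewrite le_eqVlt; apply/orP; left; apply/eqP; field.
by rewrite gt_eqF.
Qed.

(** The slope is the supremum of the chord slopes to the left of [x], and every chord slope to the
    right is an upper bound; [a] and [b] make both families nonempty. *)
Lemma supporting_line (R : realType) (D : set R) (phi : R -> R) (a x b : R) :
  @convex_function R R^o D phi -> D a -> D x -> D b -> a < x < b ->
  exists c, forall y, D y -> phi x + c * (y - x) <= phi y.
Proof.
move=> cvx Da Dx Db /andP[ax xb].
pose S : set R := [set s | exists z,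
    [/\ D z, z < x & s = (phi x - phi z) / (x - z)]]%classic.
have S_ub y : D y -> x < y -> ubound S ((phi y - phi x) / (y - x)).
  move=> Dy xy _ [z [Dz zx ->]].
  have zxy : z <= x <= y by lra.
  have := convex_function_chord cvx Dz Dy zxy.
  rewrite ler_pdivrMr ?subr_gt0 // mulrAC ler_pdivlMr ?subr_gt0 //; nra.
have S0 : (S !=set0)%classic by exists ((phi x - phi a) / (x - a)), a.
exists (sup S) => y Dy; have [xy|yx|->] := ltgtP x y; last by rewrite subrr mulr0 addr0.
- have : sup S <= (phi y - phi x) / (y - x) by apply: ge_sup => //; exact: S_ub.
  rewrite ler_pdivlMr ?subr_gt0 //; lra.
- have : (phi x - phi y) / (x - y) <= sup S.
    apply: ub_le_sup; last by exists y.
    by exists ((phi b - phi x) / (b - x)); exact: S_ub.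
  rewrite ler_pdivrMr ?subr_gt0 //; nra.
Qed.

Lemma concave_nneg_chord (R : realType) (f : R -> R) (a x b : R) :
  concave_nneg f -> 0 <= a -> a <= x <= b ->
  (b - x) * f a + (x - a) * f b <= (b - a) * f x.
Proof.
move=> cf a0 /andP[ax xb].
have Da : `[0, +oo[%classic a by rewrite /= in_itv /= a0.
have Db : `[0, +oo[%classic b by rewrite /= in_itv /= andbT; lra.
have axb : a <= x <= b by rewrite ax.
have := convex_function_chord cf Da Db axb; lra.
Qed.

(** If [f y < f x], the line through these two points becomes negative further to the right, and
    concavity keeps [f] below it. *)
Lemma concave_nneg_nondecreasing (R : realType) (f : R -> R) :
  (forall x, 0 <= x -> 0 <= f x) -> concave_nneg f ->
  forall x y, 0 <= x -> x <= y -> f x <= f y.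
Proof.
move=> f0 cf x y x0 xy; rewrite leNgt; apply/negP => fyx.
have d0 : 0 < f x - f y by rewrite subr_gt0.
have y0 : 0 <= y by lra.
(* The chord inequality for [x <= y <= y + t] yields [t (f x - f y) <= (y - x) f y]; this [t] makes
   the left side larger by 1. *)
pose t := ((y - x) * f y + 1) / (f x - f y).
have tE : t * (f x - f y) = (y - x) * f y + 1 by rewrite mulfVK // gt_eqF.
have num0 : 0 <= (y - x) * f y by rewrite mulr_ge0 ?f0 //; lra.
have t0 : 0 <= t by rewrite divr_ge0 //; lra.
have xyt : x <= y <= y + t by lra.
have := concave_nneg_chord cf x0 xyt.
have : 0 <= (y - x) * f (y + t) by rewrite mulr_ge0 ?f0 //; lra.
nra.
Qed.

Lemma concave_nneg_subr (R : realType) (f : R -> R) (c : R) :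
  concave_nneg f -> concave_nneg (fun x => f x - c).
Proof.
move=> cf t x y Dx Dy; have := cf t x y Dx Dy.
rewrite /conv /= /conv /= /GRing.scale /= /unstable.onem; lra.
Qed.

Lemma e_convex_subr (R : realType) (f : R -> R) (c : R) :
  e_convex f -> e_convex (fun x => f x - c).
Proof.
move=> cf t x y Dx Dy; have := cf t x y Dx Dy.
rewrite /conv /= /conv /= /GRing.scale /= /unstable.onem; lra.
Qed.

(** Midpoint convexity of [f (expR t)] between [ln a] and [ln b]; the point on the left is the
    geometric mean of [a] and [b]. *)
Lemma e_convex_geometric_mean (R : realType) (f : R -> R) (a b : R) :
  e_convex f -> 0 < a -> 0 < b ->
  f (expR ((ln a + ln b) / 2)) <= (f a + f b) / 2.
Proof.
move=> cf.
wlog ab : a b / ln a <= ln b => [wl a0 b0|a0 b0].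
  have [/wl|/ltW/wl] := leP (ln a) (ln b); first exact.
  by rewrite addrC [f b + _]addrC; exact.
have le_m : ln a <= (ln a + ln b) / 2 <= ln b by lra.
have := convex_function_chord cf (a := ln a) (b := ln b) I I le_m.
rewrite !lnK ?posrE //.
have [lab|lab] := ltP (ln a) (ln b); last first.
  have eab : ln a = ln b by lra.
  have -> : (ln a + ln b) / 2 = ln a by lra.
  by move/ln_inj: eab => <- //; rewrite lnK ?posrE //; lra.
rewrite [ln b - (ln a + ln b) / 2](_ : _ = (ln b - ln a) / 2); last by lra.
rewrite [(ln a + ln b) / 2 - ln a](_ : _ = (ln b - ln a) / 2); last by lra.
by rewrite -mulrDr -mulrA ler_pM2l ?subr_gt0 // [2^-1 * _]mulrC.
Qed.

Lemma sumr_ge0_abel (R : realDomainType) (c d : nat -> R) (m : nat) :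
  (forall k, 0 <= c k) -> (forall k, (k.+1 < m)%N -> c k.+1 <= c k) ->
  (forall k, (k <= m)%N -> 0 <= \sum_(j < k) d j) ->
  0 <= \sum_(k < m) c k * d k.
Proof.
case: m => [|m] c0 cN d0; first by rewrite big_ord0.
(* Summation by parts as an induction: the prefix sums of [d] being nonnegative, replacing the
   weights up to [k] by the smallest one, [c k], does not increase the sum. *)
suff H k : (k <= m)%N ->
    c k * (\sum_(j < k.+1) d j) <= \sum_(j < k.+1) c j * d j.
  by apply: le_trans (H m (leqnn m)); rewrite mulr_ge0 ?d0.
elim: k => [|k IH] km; first by rewrite !big_ord_recr !big_ord0 /= !add0r.
rewrite big_ord_recr [leRHS]big_ord_recr /= mulrDr lerD2r.
apply: le_trans (IH (ltnW km)); rewrite ler_wpM2r ?d0 // ?cN //.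
exact: ltnW.
Qed.

(** Tomic-Weyl: the supporting slopes at the [x k] are nonnegative because [F] is nondecreasing, and
    nonincreasing in [k] because [x] is sorted. Abel summation against [y - x] then bounds the sum
    of the supporting lines from below. *)
Lemma convex_weak_majorization (R : realType) (F : R -> R) (x y : nat -> R)
    (m : nat) :
  @convex_function R R^o setT F -> {homo F : s t / s <= t} ->
  (forall k, (k.+1 < m)%N -> x k.+1 <= x k) ->
  (forall k, (k <= m)%N -> \sum_(j < k) x j <= \sum_(j < k) y j) ->
  \sum_(k < m) F (x k) <= \sum_(k < m) F (y k).
Proof.
move=> cF ndF xN xy.
have /choice[c cP] (s : R) : exists c, forall t, F s + c * (t - s) <= F t.
  have ss : s - 1 < s < s + 1 by lra.
  have [c cP] := supporting_line cF (a := s - 1) (x := s) (b := s + 1) I I I ss.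
  by exists c => t; exact: cP.
have c0 s : 0 <= c s.
  have := cP s (s - 1); have : F (s - 1) <= F s by apply: ndF; lra.
  lra.
have c_nd s t : s <= t -> c s <= c t.
  rewrite le_eqVlt => /orP[/eqP->//|st].
  have := cP s t; have := cP t s; nra.
have := @sumr_ge0_abel R (c \o x) (fun k => y k - x k) m.
have -> : \sum_(k < m) (c \o x) k * (y k - x k) =
          \sum_(k < m) (F (x k) + c (x k) * (y k - x k)) - \sum_(k < m) F (x k).
  by rewrite -sumrB; apply: eq_bigr => k _; rewrite addrAC subrr add0r.
rewrite subr_ge0 => H; apply: (le_trans (H _ _ _)).
- by move=> k; exact: c0.
- by move=> k km; apply/c_nd/xN.
- by move=> k km; rewrite sumrB subr_ge0 xy.
- by apply: ler_sum => k _; exact: cP.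
Qed.

Lemma ln_prod (R : realType) (a : nat -> R) (m : nat) :
  (forall k, (k < m)%N -> 0 < a k) ->
  0 < \prod_(k < m) a k /\ ln (\prod_(k < m) a k) = \sum_(k < m) ln (a k).
Proof.
elim: m => [|m IH] a0; first by rewrite !big_ord0 ln1.
have [|p0 pE] := IH _; first by move=> k km; apply: a0; exact: ltnW.
by rewrite !big_ord_recr /= mulr_gt0 ?a0 // lnM ?posrE ?a0 // pE.
Qed.

Lemma factor_gt0_of_prod (R : realDomainType) (a : nat -> R) (m : nat) :
  (forall k, 0 <= a k) -> 0 < \prod_(k < m) a k ->
  forall k, (k < m)%N -> 0 < a k.
Proof.
move=> a0 pa k km; rewrite lt_neqAle a0 andbT eq_sym; apply/negP => /eqP ak.
by move: pa; rewrite (bigD1 (Ordinal km)) //= ak mul0r ltxx.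
Qed.

(** Logarithms turn the product inequalities into weak majorization of [ln a] by
    [(ln r + ln c) / 2], to which the convex nondecreasing function [g (expR t)] is applied. *)
Lemma e_convex_weak_log_majorization (R : realType) (g : R -> R)
    (a r c : nat -> R) (m : nat) :
  e_convex g -> (forall x y, 0 <= x -> x <= y -> g x <= g y) -> g 0 = 0 ->
  (forall k, 0 <= a k) -> (forall k, 0 <= r k) -> (forall k, 0 <= c k) ->
  (forall k l, (k <= l)%N -> a l <= a k) ->
  (forall k, (k <= m)%N ->
    \prod_(j < k) a j ^+ 2 <= (\prod_(j < k) r j) * (\prod_(j < k) c j)) ->
  \sum_(k < m) g (a k) <= (\sum_(k < m) g (r k) + \sum_(k < m) g (c k)) / 2.
Proof.
move=> cg ndg g0 a0 r0 c0 aN.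
have g_ge0 x : 0 <= x -> 0 <= g x by move=> x0; rewrite -g0; exact: ndg.
elim: m => [|m IH] H; first by rewrite !big_ord0 addr0 mul0r.
have {}IH := IH (fun k km => H k (leqW km)).
(* A last term [a m = 0] contributes [g 0 = 0], and the induction hypothesis suffices. Otherwise all
   [a k] are positive, the full product inequality makes all [r k] and [c k] positive, and
   logarithms may be taken. *)
have := a0 m; rewrite le_eqVlt => /orP[/eqP am0|am_gt0].
  rewrite !big_ord_recr /= -am0 g0.
  have := g_ge0 _ (r0 m); have := g_ge0 _ (c0 m); lra.
have a_gt0 k : (k < m.+1)%N -> 0 < a k by rewrite ltnS => km; apply: lt_le_trans (aN _ _ km).
have a2_gt0 k : (k <= m.+1)%N -> 0 < \prod_(j < k) a j ^+ 2.
  by move=> km; apply: prodr_gt0 => j _; rewrite exprn_gt0 // a_gt0 // (leq_trans _ km).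
have [pr_gt0 pc_gt0] : 0 < \prod_(j < m.+1) r j /\ 0 < \prod_(j < m.+1) c j.
  have := lt_le_trans (a2_gt0 _ (leqnn _)) (H _ (leqnn _)).
  have : 0 <= \prod_(j < m.+1) r j by rewrite prodr_ge0.
  have : 0 <= \prod_(j < m.+1) c j by rewrite prodr_ge0.
  rewrite le_eqVlt => /orP[/eqP<-|pc]; first by rewrite mulr0 ltxx.
  rewrite le_eqVlt => /orP[/eqP<-|pr]; first by rewrite mul0r ltxx.
  by [].
have r_gt0 := factor_gt0_of_prod r0 pr_gt0; have c_gt0 := factor_gt0_of_prod c0 pc_gt0.
apply: (@le_trans _ _ (\sum_(k < m.+1) g (expR ((ln (r k) + ln (c k)) / 2)))).
  have -> : \sum_(k < m.+1) g (a k) = \sum_(k < m.+1) g (expR (ln (a k))).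
    by apply: eq_bigr => k _; rewrite lnK // posrE a_gt0.
  apply: (@convex_weak_majorization R (fun t => g (expR t)) (fun k => ln (a k))
    (fun k => (ln (r k) + ln (c k)) / 2) m.+1) => //.
  - by move=> s t st; apply: ndg; rewrite ?expR_ge0 // ler_expR.
  - by move=> k km /=; rewrite ler_ln ?posrE ?a_gt0 // 1?ltnW // aN.
  - move=> k km /=.
    have lt_km j : (j < k)%N -> (j < m.+1)%N by move=> jk; exact: leq_trans km.
    have [pa pa_ln] := @ln_prod R (fun j => a j ^+ 2) k
      (fun j jk => exprn_gt0 2 (a_gt0 _ (lt_km j jk))).
    have [pr pr_ln] := @ln_prod R r k (fun j jk => r_gt0 _ (lt_km j jk)).
    have [pc pc_ln] := @ln_prod R c k (fun j jk => c_gt0 _ (lt_km j jk)).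
    have := H k km; rewrite -ler_ln ?posrE ?mulr_gt0 //.
    rewrite lnM ?posrE // pa_ln pr_ln pc_ln -big_split /= -mulr_suml.
    rewrite ler_pdivlMr // => /(le_trans _); apply.
    rewrite mulr_suml le_eqVlt; apply/orP; left; apply/eqP.
    by apply: eq_bigr => j _; rewrite lnXn ?a_gt0 ?lt_km // mulr_natr.
rewrite -big_split /= mulr_suml; apply: ler_sum => k _.
by apply: e_convex_geometric_mean; rewrite ?r_gt0 ?c_gt0.
Qed.

(** The contribution of one rank-one term: [b] is its coefficient, [w] the squared coordinates of
    its unit vector in an eigenbasis of the sum, [c] the eigenvalues. The predicate [P] selects the
    eigenvalues above a threshold [s]. *)
Lemma concave_frame_le (R : realType) (g : R -> R) (I : finType) (P : pred I)
    (w c : I -> R) (b s : R) :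
  (forall x, 0 <= x -> 0 <= g x) -> concave_nneg g -> g 0 = 0 ->
  (forall k, 0 <= w k) -> (forall k, 0 <= c k) -> \sum_k w k = 1 ->
  0 <= b -> b * (\sum_k w k / c k) <= 1 -> (forall k, c k = 0 -> b * w k = 0) ->
  0 < s -> (forall k, P k -> s <= c k) -> (forall k, ~~ P k -> c k <= s) ->
  b * (\sum_(k | P k) w k * (g (c k) / c k)) <= g b * (\sum_(k | P k) w k).
Proof.
move=> g_ge0 cg g0 w0 c0 w1 b0 bw bc s0 Ps nPs.
(* If [b <= s], every selected [c k] is at least [b], and the bound holds termwise because [g x / x]
   is nonincreasing. *)
rewrite !mulr_sumr; have [bs|sb] := leP b s.
  apply: ler_sum => k Pk; have ck := Ps _ Pk; have ck0 : 0 < c k by lra.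
  rewrite mulrCA [g b * _]mulrC ler_wpM2l // mulrA ler_pdivrMr // -subr_ge0.
  have bck : 0 <= b <= c k by lra.
  have := concave_nneg_chord cg (lexx _) bck; rewrite g0; lra.
(* With g <= p - c' x a supporting line at b, the k-th term of the difference is
   at least p w_k (1 - b / c_k), and the omitted terms of that sum are <= 0. *)
have b_gt0 : 0 < b by lra.
have Db : `[0, +oo[%classic b by rewrite /= in_itv /= b0.
have D0 : `[0, +oo[%classic (0 : R) by rewrite /= in_itv /= lexx.
have Db1 : `[0, +oo[%classic (b + 1) by rewrite /= in_itv /= andbT; lra.
have bb1 : 0 < b < b + 1 by lra.
have [c' c'P] := supporting_line cg D0 Db Db1 bb1.
pose p := g b + c' * b.
have p0 : 0 <= p by have := c'P _ D0; rewrite g0 /p; lra.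
have gP x : 0 <= x -> g x <= p - c' * x.
  move=> x0; have Dx : `[0, +oo[%classic x by rewrite /= in_itv /= x0.
  by have := c'P _ Dx; rewrite /p; lra.
rewrite -subr_ge0 -sumrB.
apply: (@le_trans _ _ (\sum_(k | P k) p * (w k - b * (w k / c k)))); last first.
  apply: ler_sum => k Pk; have ck := Ps _ Pk; have ck0 : 0 < c k by lra.
  have -> : p * (w k - b * (w k / c k)) = g b * w k - b * (w k * ((p - c' * c k) / c k)).
    by rewrite /p; field; rewrite gt_eqF.
  by rewrite lerD2l lerN2 ler_wpM2l // ler_wpM2l // ler_pM2r ?invr_gt0 // gP.
rewrite -mulr_sumr mulr_ge0 //.
have : 0 <= \sum_k (w k - b * (w k / c k)) by rewrite sumrB w1 -mulr_sumr; lra.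
rewrite (bigID P) /= => /le_trans; apply; rewrite gerDl.
(* At [c k = 0] the quotient is 0 by convention, so the term is [w k]; it vanishes since
   [b * w k = 0] and [b > 0]. *)
apply: sumr_le0 => k nPk; have := c0 k; rewrite le_eqVlt => /orP[/eqP ck|ck].
  have /eqP := bc _ (esym ck); rewrite mulf_eq0 gt_eqF //= => /eqP ->.
  by rewrite mul0r mulr0 subrr.
rewrite subr_le0 mulrCA ler_peMr // ler_pdivlMr // mul1r.
have := nPs _ nPk; lra.
Qed.

(** Without positive parts the right side is [b - s b sum_k w_k / c_k], which is at least [b - s];
    taking positive parts only increases it. *)
Lemma superadditive_frame_le (R : realFieldType) (I : finType) (w c : I -> R)
    (b s : R) :
  (forall k, 0 <= w k) -> (forall k, 0 <= c k) -> \sum_k w k = 1 ->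
  0 <= b -> b * (\sum_k w k / c k) <= 1 -> (forall k, c k = 0 -> b * w k = 0) ->
  0 <= s -> Num.max (b - s) 0 <= \sum_k b * w k * (Num.max (c k - s) 0 / c k).
Proof.
move=> w0 c0 w1 b0 bw bc s0; rewrite ge_max; apply/andP; split; last first.
  apply: sumr_ge0 => k _; rewrite mulr_ge0 ?mulr_ge0 ?invr_ge0 //.
  by rewrite le_max lexx orbT.
apply: (@le_trans _ _ (\sum_k (b * w k - s * (b * (w k / c k))))).
  by rewrite sumrB -!mulr_sumr w1 mulr1 lerD2l lerN2 ler_piMr.
apply: ler_sum => k _; have := c0 k; rewrite le_eqVlt => /orP[/eqP ck|ck].
  by rewrite bc // mul0r -ck invr0 !mulr0 subr0.
have -> : b * w k - s * (b * (w k / c k)) = b * w k * ((c k - s) / c k).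
  by field; rewrite gt_eqF.
rewrite ler_wpM2l ?mulr_ge0 // ler_pM2r ?invr_gt0 //.
by rewrite le_max lexx.
Qed.

(** * Determinants of Gram matrices *)

(** Multilinearity in the rows: [f] records which summand is chosen in each row. *)
Lemma det_sum_rows (K : comNzRingType) (T : finType) (m : nat)
    (x : 'I_m -> T -> K) (y : T -> 'I_m -> K) :
  \det (\matrix_(i, j) \sum_t x i t * y t j)
  = \sum_(f : {ffun 'I_m -> T}) (\prod_i x i (f i)) * \det (\matrix_(i, j) y (f i) j).
Proof.
rewrite /determinant; under [RHS]eq_bigr do rewrite mulr_sumr.
rewrite [RHS]exchange_big /=; apply: eq_bigr => s _.
under eq_bigr do rewrite mxE.
rewrite bigA_distr_bigA mulr_sumr; apply: eq_bigr => f _ /=.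
rewrite big_split /= mulrCA; congr (_ * (_ * _)).
by apply: eq_bigr => i _; rewrite mxE.
Qed.

(* Summing over all functions instead of increasing ones avoids ordering [T], at
   the price of the factor [m`!]; non-injective functions contribute [0]. *)
Lemma cauchy_binet (K : comNzRingType) (T : finType) (m : nat)
    (x : 'I_m -> T -> K) (y : T -> 'I_m -> K) :
  m`!%:R * \det (\matrix_(i, j) \sum_t x i t * y t j)
  = \sum_(f : {ffun 'I_m -> T})
      \det (\matrix_(i, j) x i (f j)) * \det (\matrix_(i, j) y (f i) j).
Proof.
pose F (f : {ffun 'I_m -> T}) := \det (\matrix_(i, j) y (f i) j).
(* Reindexing [f] by [s] permutes the rows of the second minor and produces the sign of [s]. Adding
   these identities over all [s] assembles the first minor. *)
have permF (s : 'S_m) :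
    \det (\matrix_(i, j) \sum_t x i t * y t j)
    = \sum_(f : {ffun 'I_m -> T}) (-1) ^+ s * (\prod_i x i (f (s i))) * F f.
  rewrite det_sum_rows.
  rewrite (reindex (fun f : {ffun 'I_m -> T} => [ffun i => f (s i)])) /=; last first.
    exists (fun f : {ffun 'I_m -> T} => [ffun i => f ((s^-1)%g i)]) => f _;
      by apply/ffunP=> i; rewrite !ffunE ?permK ?permKV.
  apply: eq_bigr => f _.
  have -> : \matrix_(i, j) y ([ffun i => f (s i)] i) j
            = row_perm s (\matrix_(i, j) y (f i) j).
    by apply/matrixP => i j; rewrite !mxE ffunE.
  rewrite row_permE det_mulmx det_perm mulrCA mulrA; congr (_ * _ * _).
  by apply: eq_bigr => i _; rewrite ffunE.
rewrite -card_Sn -sum1_card natr_sum mulr_suml.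
under eq_bigr => s _ do rewrite mul1r (permF s).
rewrite exchange_big /=; apply: eq_bigr => f _; rewrite -mulr_suml; congr (_ * _).
by apply: eq_bigr => s _; congr (_ * _); apply: eq_bigr => i _; rewrite mxE.
Qed.

Lemma ler_prod_uniq (K : numDomainType) (d : nat -> K) (k : nat) (s : seq nat) :
  (forall i, 0 <= d i) -> (forall i j, (i <= j)%N -> d j <= d i) ->
  path ltn k s -> \prod_(i <- s) d i <= \prod_(i < size s) d (k + i).+1.
Proof.
move=> d0 dN; elim: s k => [|a s IH] k /=; first by rewrite big_nil big_ord0.
move=> /andP[ka sa]; rewrite big_cons big_ord_recl /=.
apply: ler_pM; rewrite ?d0 ?prodr_ge0 //; first by rewrite dN // addn0.
apply: le_trans (IH _ sa) _; apply: ler_prod => i _; rewrite d0 /=.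
by apply: dN; rewrite /bump /=; lia.
Qed.

(** Sorted increasingly, distinct naturals satisfy [s_i >= i], so each factor is at most the one of
    the same rank on the right. *)
Lemma ler_prod_injective (K : numDomainType) (d : nat -> K) (m : nat)
    (f : 'I_m -> nat) :
  (forall i, 0 <= d i) -> (forall i j, (i <= j)%N -> d j <= d i) ->
  injective f -> \prod_i d (f i) <= \prod_(i < m) d i.
Proof.
move=> d0 dN finj.
pose s := sort leq (map f (enum 'I_m)).
have s_size : size s = m by rewrite size_sort size_map size_enum_ord.
have s_sorted : sorted ltn s.
  by rewrite ltn_sorted_uniq_leq sort_uniq map_inj_uniq // enum_uniq sort_sorted //;
    exact: leq_total.
have -> : \prod_i d (f i) = \prod_(i <- s) d i.
  by rewrite (perm_big _ (permEl (perm_sort _ _))) big_map big_enum.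
case: s s_size s_sorted => [|a s] /= <- sP; first by rewrite big_nil big_ord0.
rewrite big_cons big_ord_recl /=; apply: ler_pM; rewrite ?d0 ?prodr_ge0 ?dN //.
apply: le_trans (ler_prod_uniq d0 dN sP) _; apply: ler_prod => i _; rewrite d0 /=.
by apply: dN; rewrite /bump /=; lia.
Qed.

(** Lagrange's identity: twice the difference is the sum of [c_i c_j (a_i b_j - a_j b_i)^2]. *)
Lemma ler_sum_sqr_weighted (K : numFieldType) (I : finType) (c a b : I -> K) :
  (forall i, 0 <= c i) -> (forall i, 0 <= a i) -> (forall i, 0 <= b i) ->
  (\sum_i c i * (a i * b i)) ^+ 2
  <= (\sum_i c i * a i ^+ 2) * (\sum_i c i * b i ^+ 2).
Proof.
move=> c0 a0 b0; rewrite -(ler_pM2l (x := 2%:R)) ?ltr0n // expr2 -subr_ge0.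
have -> : 2%:R * ((\sum_i c i * a i ^+ 2) * (\sum_i c i * b i ^+ 2))
    - 2%:R * ((\sum_i c i * (a i * b i)) * (\sum_i c i * (a i * b i)))
    = \sum_i \sum_j c i * c j * (a i * b j - a j * b i) ^+ 2.
  rewrite mulr2n mulrDl mul1r {2}[(\sum_i c i * a i ^+ 2) * _]mulrC !mulr_suml.
  rewrite mulr_sumr -big_split /= -sumrB; apply: eq_bigr => i _.
  rewrite !mulr_sumr -big_split /= -sumrB; apply: eq_bigr => j _.
  ring.
apply: sumr_ge0 => i _; apply: sumr_ge0 => j _.
apply: mulr_ge0; first by rewrite mulr_ge0.
by rewrite real_exprn_even_ge0 // rpredB // ger0_real // mulr_ge0.
Qed.

Section WeightedGram.
Variables (C : numClosedFieldType) (T : finType) (m : nat).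
Implicit Types (d : T -> C) (x y : T -> 'I_m -> C).

(** This is [X^* D X], where [X] has the rows [x t] and [D] is the diagonal matrix of [d]. *)
Definition wgram d x : 'M[C]_m :=
  \matrix_(i, j) \sum_t d t * (Num.conj (x t i) * x t j).

Definition minor x (f : {ffun 'I_m -> T}) : C := \det (\matrix_(i, j) x (f i) j).

Lemma cauchy_binet_weighted d x y :
  m`!%:R * \det (\matrix_(i, j) \sum_t d t * (Num.conj (x t i) * y t j))
  = \sum_(f : {ffun 'I_m -> T}) (\prod_i d (f i)) * (Num.conj (minor x f) * minor y f).
Proof.
have -> : \matrix_(i, j) (\sum_t d t * (Num.conj (x t i) * y t j))
        = \matrix_(i, j) \sum_t Num.conj (x t i) * (d t * y t j).
  by apply/matrixP => i j; rewrite !mxE; apply: eq_bigr => t _; rewrite mulrCA.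
rewrite (cauchy_binet (fun i t => Num.conj (x t i)) (fun t j => d t * y t j)).
apply: eq_bigr => f _; rewrite mulrCA; congr (_ * _).
  rewrite -det_map_mx -det_tr; congr (\det _).
  by apply/matrixP => i j; rewrite !mxE.
have -> : \matrix_(i, j) (d (f i) * y (f i) j)
        = diag_mx (\row_i d (f i)) *m \matrix_(i, j) y (f i) j.
  by apply/matrixP => i j; rewrite mul_diag_mx !mxE.
rewrite det_mulmx det_diag; congr (_ * _).
by apply: eq_bigr => i _; rewrite mxE.
Qed.

Lemma det_wgram d x :
  m`!%:R * \det (wgram d x) = \sum_(f : {ffun 'I_m -> T}) (\prod_i d (f i)) * `|minor x f| ^+ 2.
Proof.
by rewrite cauchy_binet_weighted; apply: eq_bigr => f _; rewrite normCK [Num.conj _ * _]mulrC.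
Qed.

Lemma det_wgram_ge0 d x : (forall t, 0 <= d t) -> 0 <= \det (wgram d x).
Proof.
move=> d0; rewrite -(pmulr_rge0 _ (x := m`!%:R)) ?ltr0n ?fact_gt0 // det_wgram.
by apply: sumr_ge0 => f _; rewrite mulr_ge0 ?exprn_ge0 ?prodr_ge0.
Qed.

(** In the Cauchy-Binet expansion a non-injective [f] gives a minor with two equal rows, so it is
    enough to bound the weights of the injective ones. *)
Lemma det_wgram_le d x (B : C) :
  (forall f : 'I_m -> T, injective f -> \prod_i d (f i) <= B) ->
  \det (wgram d x) <= B * \det (wgram (fun=> 1) x).
Proof.
move=> dB; rewrite -(ler_pM2l (x := m`!%:R)) ?ltr0n ?fact_gt0 //.
rewrite mulrCA !det_wgram mulr_sumr; apply: ler_sum => f _.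
rewrite [X in B * (X * _)]big1 // mul1r.
have [/injectiveP finj|] := boolP (injectiveb f).
  by rewrite ler_wpM2r ?exprn_ge0 // dB.
move=> /injectivePn[i [j ij fij]]; rewrite /minor (determinant_alternate ij).
  by rewrite normr0 expr0n /= !mulr0.
by move=> k; rewrite !mxE fij.
Qed.

(** Cauchy-Binet writes the mixed determinant as a sum over [f] of products of minors of [x] and
    [y]. The triangle inequality and the scalar Cauchy-Schwarz inequality with weights
    [prod |d (f i)|] separate the two. *)
Lemma det_wgram_CauchySchwarz (d : T -> C) x y :
  `|\det (\matrix_(i, j) \sum_t d t * (Num.conj (x t i) * y t j))| ^+ 2
  <= \det (wgram (fun t => `|d t|) x) * \det (wgram (fun t => `|d t|) y).
Proof.
have m0 : 0 < m`!%:R :> C by rewrite ltr0n fact_gt0.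
have sqr_le : (m`!%:R * `|\det (\matrix_(i, j) \sum_t d t * (Num.conj (x t i) * y t j))|) ^+ 2
    <= (m`!%:R * \det (wgram (fun t => `|d t|) x))
       * (m`!%:R * \det (wgram (fun t => `|d t|) y)).
  rewrite -{1}normr_nat -normrM cauchy_binet_weighted !det_wgram.
  apply: le_trans (ler_sum_sqr_weighted _ _ _) => [|f|f|f] //; last first.
    by rewrite prodr_ge0.
  rewrite ler_pXn2r ?nnegrE ?sumr_ge0 // => [|f _]; last first.
    by rewrite !mulr_ge0 ?prodr_ge0.
  apply: le_trans (ler_norm_sum _ _ _) _; apply: ler_sum => f _.
  by rewrite !normrM norm_conjC normr_prod.
by move: sqr_le; rewrite exprMn [leRHS]mulrACA -[X in _ <= X * _]expr2 ler_pM2l // exprn_gt0.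
Qed.

End WeightedGram.

(** * Rank-one decompositions and spectra *)

(** The squared modulus as an element of [R]; the norm on [R[i]] takes its values in [R[i]]. *)
Definition sqn (R : rcfType) (z : R[i]) : R := complex.Re z ^+ 2 + complex.Im z ^+ 2.

Lemma sqnE (R : rcfType) (z : R[i]) : (sqn z)%:C = Num.conj z * z.
Proof. by rewrite /sqn add_Re2_Im2 normCK mulrC. Qed.

Lemma sqn_ge0 (R : rcfType) (z : R[i]) : 0 <= sqn z.
Proof. by rewrite addr_ge0 ?sqr_ge0. Qed.

Lemma conjC_real_complex (R : rcfType) (x : R) : Num.conj x%:C = x%:C.
Proof. by apply: CrealP; rewrite complex_real. Qed.

(* [z t k] is the k-th coordinate of y_t in an eigenbasis of sum_t c_t y_t^* y_t.
   Quotients by [d k] are harmless at a zero eigenvalue, since 0^-1 = 0. *)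
Section Frames.
Variables (R : realType) (T : finType) (N : nat).
Variables (c : T -> R) (z : T -> 'I_N -> R[i]) (d : nat -> R).
Hypothesis c_ge0 : forall t, 0 <= c t.
Hypothesis d_ge0 : forall k, 0 <= d k.
Hypothesis z_diag : forall k l : 'I_N,
  \sum_t (c t)%:C * (Num.conj (z t k) * z t l) = (d k)%:C *+ (k == l).

Lemma frame_diag (k : 'I_N) : \sum_t c t * sqn (z t k) = d k.
Proof.
apply: complexI; have := z_diag k k; rewrite eqxx mulr1n => <-; rewrite rmorph_sum.
by apply: eq_bigr => t _; rewrite /= rmorphM /= sqnE.
Qed.

Lemma frame_weight_eq0 t (k : 'I_N) : d k = 0 -> c t * sqn (z t k) = 0.
Proof.
rewrite -frame_diag => /eqP; rewrite psumr_eq0 => [/allP/(_ t)|s _].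
  by rewrite mem_index_enum => /(_ isT)/eqP.
by rewrite mulr_ge0 ?sqn_ge0.
Qed.

(* [c t z_t^* z_t <= diag d] gives [c t z_t (diag d)^+ z_t^* <= 1]. *)
Lemma frame_weight_le1 t : c t * (\sum_(k < N) sqn (z t k) / d k) <= 1.
Proof.
set W := \sum_(k < N) _.
have W0 : 0 <= W by apply: sumr_ge0 => k _; rewrite divr_ge0 ?sqn_ge0.
(* [u s] pairs [z t] with [z s] through the inverse of [diag d]. By [z_diag] the sum of
   [c_s |u_s|^2] is [W], while its term at [s = t] is [c_t W^2]. *)
pose u s := \sum_(k < N) Num.conj (z t k) * (d k)^-1%:C * z s k.
have uE : u t = W%:C.
  rewrite /W rmorph_sum; apply: eq_bigr => k _ /=.
  by rewrite rmorphM /= sqnE mulrAC.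
have uW : \sum_s c s * sqn (u s) = W.
  apply: complexI; rewrite rmorph_sum /=.
  transitivity (\sum_(k < N) \sum_(l < N) (z t k * Num.conj (z t l) * ((d k)^-1 * (d l)^-1)%:C) *
      \sum_s (c s)%:C * (Num.conj (z s k) * z s l)); last first.
    rewrite /W rmorph_sum; apply: eq_bigr => k _ /=.
    rewrite (bigD1 k) //= z_diag eqxx mulr1n big1 ?addr0 => [|l lk]; last first.
      by rewrite z_diag eq_sym (negPf lk) mulr0n mulr0.
    rewrite [z t k * _]mulrC -sqnE -!rmorphM /=; congr (_%:C).
    have [->|dk] := eqVneq (d k) 0; first by rewrite invr0 !(mulr0, mul0r).
    by field.
  under [RHS]eq_bigr => k _.
    under eq_bigr => l _ do rewrite mulr_sumr.
    rewrite exchange_big; over.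
  rewrite [RHS]exchange_big /=; apply: eq_bigr => s _.
  rewrite rmorphM /= sqnE /u rmorph_sum mulr_suml mulr_sumr; apply: eq_bigr => k _.
  rewrite mulr_sumr mulr_sumr; apply: eq_bigr => l _ /=.
  by rewrite !rmorphM /= conjCK conjC_real_complex; ring.
have : c t * W ^+ 2 <= W.
  rewrite -[leRHS]uW (bigD1 t) //= uE /sqn /= expr0n addr0 lerDl.
  by apply: sumr_ge0 => s _; rewrite mulr_ge0 ?sqn_ge0.
move: W0; rewrite le_eqVlt => /orP[/eqP<-|W0]; first by rewrite mulr0.
by rewrite expr2 mulrA ger_pMl.
Qed.

Hypothesis z_unit : forall t, \sum_(k < N) sqn (z t k) = 1.

(** For [d_k > 0], [g (d_k)] equals the sum over [t] of [c_t |z_tk|^2 g (d_k) / d_k];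
    [concave_frame_le] then bounds the part of each [t]. Zero eigenvalues are dropped first, since
    [g 0 = 0]. *)
Lemma concave_frame_sum (g : R -> R) (m : nat) :
  (forall x, 0 <= x -> 0 <= g x) -> concave_nneg g -> g 0 = 0 ->
  (forall k l, (k <= l)%N -> d l <= d k) ->
  \sum_(k < N | (k < m)%N) g (d k)
  <= \sum_t g (c t) * \sum_(k < N | (k < m)%N) sqn (z t k).
Proof.
move=> g_ge0 cg g0 dN; pose P (k : 'I_N) := (k < m)%N && (0 < d k).
have -> : \sum_(k < N | (k < m)%N) g (d k) = \sum_(k < N | P k) g (d k).
  rewrite (bigID (fun k : 'I_N => 0 < d k)) /= [X in _ + X]big1 ?addr0 //.
  by move=> k /andP[_]; rewrite lt_neqAle d_ge0 andbT negbK => /eqP<-.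
apply: (@le_trans _ _ (\sum_t g (c t) * \sum_(k < N | P k) sqn (z t k))); last first.
  apply: ler_sum => t _; rewrite ler_wpM2l ?g_ge0 //.
  rewrite [leRHS](bigID (fun k : 'I_N => 0 < d k)) /= lerDl.
  by apply: sumr_ge0 => k _; exact: sqn_ge0.
have [k0 Pk0|P0] := pickP P; last first.
  by rewrite big_pred0 //; under eq_bigr do rewrite big_pred0 // mulr0; rewrite big1.
(* The last selected eigenvalue [d k1] is the threshold separating the selected eigenvalues from the
   others. *)
case: (arg_maxnP (fun k : 'I_N => k : nat) Pk0) => k1 Pk1 k1max.
have -> : \sum_(k < N | P k) g (d k)
    = \sum_t c t * \sum_(k < N | P k) sqn (z t k) * (g (d k) / d k).
  under [RHS]eq_bigr do rewrite mulr_sumr.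
  rewrite exchange_big /=; apply: eq_bigr => k /andP[_ dk].
  under eq_bigr do rewrite mulrA.
  by rewrite -mulr_suml frame_diag mulrC divfK // gt_eqF.
apply: ler_sum => t _; apply: (@concave_frame_le R g _ P _ (fun k => d k) (c t) (d k1)) => //.
- by move=> k; exact: sqn_ge0.
- exact: frame_weight_le1.
- by move=> k; exact: frame_weight_eq0.
- by case/andP: Pk1.
- by move=> k Pk; apply/dN/k1max.
- move=> k; rewrite negb_and -leqNgt => /orP[mk|].
    by apply: dN; apply: leq_trans mk; case/andP: Pk1 => /ltnW.
  by rewrite -leNgt => /le_trans; apply.
Qed.

(** This is superadditivity of [P -> tr (P - s)_+] on rank-one terms: [c t] is the only nonzero
    eigenvalue that the term [t] can have. *)
Lemma superadditive_frame_sum (s : R) : 0 <= s ->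
  \sum_t Num.max (c t - s) 0 <= \sum_(k < N) Num.max (d k - s) 0.
Proof.
move=> s0.
have H t : Num.max (c t - s) 0
    <= \sum_(k < N) c t * sqn (z t k) * (Num.max (d k - s) 0 / d k).
  apply: superadditive_frame_le => //.
  - by move=> k; exact: sqn_ge0.
  - exact: frame_weight_le1.
  - by move=> k; exact: frame_weight_eq0.
apply: (le_trans (ler_sum _ (fun t _ => H t))); rewrite exchange_big /=.
apply: ler_sum => k _; rewrite -mulr_suml frame_diag.
have [->|dk] := eqVneq (d k) 0; first by rewrite mul0r le_max lexx orbT.
by rewrite mulrC divfK.
Qed.

End Frames.

Lemma trmxC_mul (C : numClosedFieldType) m n p (A : 'M[C]_(m, n)) (B : 'M[C]_(n, p)) :
  (A *m B)^t* = B^t* *m A^t*.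
Proof. by rewrite trmx_mul map_mxM. Qed.

Lemma unitarymx_tK (C : numClosedFieldType) n (U : 'M[C]_n) :
  U \is unitarymx -> U^t* *m U = 1%:M.
Proof. by move=> Uu; rewrite -invmx_unitary // mulVmx // unitarymx_unit. Qed.

Lemma unitary_perm_mx (C : numClosedFieldType) n (p : 'S_n) :
  perm_mx p \is @unitarymx C n n.
Proof.
by apply/unitarymxP; rewrite tr_perm_mx map_perm_mx -perm_mxM mulgV perm_mx1.
Qed.

Section RankOneSums.
Variables (R : realType) (T : finType).
Implicit Types (M N : nat) (e : T -> R[i]) (c : T -> R).

Definition rank1_sum M N e (x : T -> 'rV[R[i]]_M) (y : T -> 'rV[R[i]]_N) : 'M[R[i]]_(M, N) :=
  \sum_t e t *: ((x t)^t* *m y t).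

Lemma mul_rank1_sum M N M' N' e (x : T -> 'rV[R[i]]_M) (y : T -> 'rV[R[i]]_N)
    (A : 'M_(M', M)) (B : 'M_(N, N')) :
  A *m rank1_sum e x y *m B = rank1_sum e (fun t => x t *m A^t*) (fun t => y t *m B).
Proof.
rewrite mulmx_sumr mulmx_suml; apply: eq_bigr => t _.
by rewrite -scalemxAr -scalemxAl trmxC_mul trmxCK !mulmxA.
Qed.

Lemma rank1_sumE M N e (x : T -> 'rV[R[i]]_M) (y : T -> 'rV[R[i]]_N) k l :
  rank1_sum e x y k l = \sum_t e t * (Num.conj (x t 0 k) * y t 0 l).
Proof.
by rewrite summxE; apply: eq_bigr => t _; rewrite !mxE big_ord1 !mxE.
Qed.

Lemma diag_rank1_sum N c (y : T -> 'rV[R[i]]_N) k :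
  rank1_sum (fun t => (c t)%:C) y y k k = (\sum_t c t * sqn (y t 0 k))%:C.
Proof.
rewrite rank1_sumE rmorph_sum; apply: eq_bigr => t _ /=.
by rewrite rmorphM /= sqnE.
Qed.

End RankOneSums.

(* The eigenvalues are listed by [nat], with 0 beyond the size of the matrix, so
   that spectra of matrices of different sizes can be compared. *)
Definition sorted_spectrum (R : realType) (N : nat) (P U : 'M[R[i]]_N) (d : nat -> R) :=
  [/\ U \is unitarymx,
      P = U^t* *m diag_mx (\row_k (d k)%:C) *m U,
      forall k, 0 <= d k,
      forall k l, (k <= l)%N -> d l <= d k &
      forall k, (N <= k)%N -> d k = 0].

Lemma psd_sorted_spectrum (R : realType) (N : nat) (P : 'M[R[i]]_N) :
  P^t* = P -> (forall v : 'rV_N, 0 <= (v *m P *m v^t*) 0 0) ->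
  exists U d, sorted_spectrum P U d.
Proof.
move=> PtP P0; have /orthomx_spectralP PE : P \is normalmx by apply/normalmxP; rewrite PtP.
pose V := spectralmx P; have Vu : V \is unitarymx by exact: spectral_unitarymx.
pose a := spectral_diag P; rewrite invmx_unitary // -/V -/a in PE.
have aE k : (row k V *m P *m (row k V)^t*) 0 0 = a 0 k.
  have : (V *m P *m V^t*) k k = a 0 k.
    by rewrite PE !mulmxA (unitarymxP Vu) mul1mx mulmxtVK // !mxE eqxx.
  move=> <-; rewrite -row_mul [LHS]mxE [RHS]mxE; apply: eq_bigr => l _.
  by rewrite !mxE.
have a_ge0 k : 0 <= a 0 k by rewrite -aE.
pose s := [tuple complex.Re (a 0 k) | k < N].
(* The permutation that sorts the eigenvalues is absorbed into [U] as a permutation of the rows of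
   [V]. *)
have [p pP] : exists p : 'S_N, sort >=%R s = [tuple tnth s (p i) | i < N].
  by apply/tuple_permP; rewrite perm_sort.
pose d k := nth 0 (sort >=%R s) k.
have s_size : size (sort >=%R s) = N by rewrite size_sort size_tuple.
have dE (k : 'I_N) : (d k)%:C = a 0 (p k).
  rewrite /d pP -tnth_nth !tnth_mktuple.
  by apply: RRe_real; apply: ger0_real.
have d0 k : (N <= k)%N -> d k = 0 by move=> Nk; rewrite /d nth_default // s_size.
have d_ge0 k : 0 <= d k.
  have [kN|Nk] := ltnP k N; last by rewrite d0.
  by rewrite -ler0c (dE (Ordinal kN)).
exists (row_perm p V), d; split; [ | | exact: d_ge0 | | exact: d0].
- rewrite row_permE; apply: mul_unitarymx; last exact: Vu.
  exact: unitary_perm_mx.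
- rewrite {1}PE; apply/matrixP => i j; rewrite !mul_mx_diag !mxE.
  rewrite (reindex_inj (@perm_inj _ p)); apply: eq_bigr => k _.
  by rewrite !mxE dE.
- move=> k l kl; have [lN|Nl] := ltnP l N; last by rewrite (d0 l).
  have sP : sorted >=%R (sort >=%R s) by apply: sort_sorted => x y; exact: le_total.
  have geT : transitive (>=%R : rel R) by move=> x y z xy yz; exact: le_trans yz xy.
  apply: (sorted_leq_nth geT (fun=> lexx _) 0 sP) => //; rewrite inE s_size //.
  exact: leq_ltn_trans lN.
Qed.

Lemma rank1_sum_sorted_spectrum (R : realType) (T : finType) (N : nat)
    (c : T -> R) (y : T -> 'rV[R[i]]_N) : (forall t, 0 <= c t) ->
  exists U d, sorted_spectrum (rank1_sum (fun t => (c t)%:C) y y) U d.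
Proof.
move=> c0; apply: psd_sorted_spectrum.
  apply/matrixP => i j; rewrite 2!mxE !rank1_sumE rmorph_sum; apply: eq_bigr => t _ /=.
  by rewrite !rmorphM /= conjCK conjC_real_complex [y t 0 j * _]mulrC.
move=> v; rewrite mul_rank1_sum diag_rank1_sum ler0c.
by apply: sumr_ge0 => t _; rewrite mulr_ge0 ?sqn_ge0.
Qed.

(** * Compressions and products of the largest eigenvalues *)

Section Spectrum.
Variables (R : realType) (N : nat) (P U : 'M[R[i]]_N) (d : nat -> R).
Hypothesis PUd : sorted_spectrum P U d.

Lemma sorted_spectrum_diag : U *m P *m U^t* = diag_mx (\row_k (d k)%:C).
Proof.
by case: PUd => Uu -> _ _ _; rewrite !mulmxA (unitarymxP Uu) mul1mx mulmxtVK.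
Qed.

(** Provides the hypothesis [z_diag] of the frame inequalities, with [z] the coordinates of [y t] in
    the eigenbasis. *)
Lemma sorted_spectrum_rank1 (T : finType) (c : T -> R) (y : T -> 'rV[R[i]]_N) k l :
  P = rank1_sum (fun t => (c t)%:C) y y ->
  \sum_t (c t)%:C * (Num.conj ((y t *m U^t*) 0 k) * (y t *m U^t*) 0 l)
  = (d k)%:C *+ (k == l).
Proof.
move=> PE; rewrite -rank1_sumE -mul_rank1_sum -PE sorted_spectrum_diag.
by rewrite !mxE.
Qed.

(** In the eigenbasis the compression is a Gram matrix with weights [d], and a product of [m]
    eigenvalues with distinct indices is at most that of the first [m]. *)
Lemma det_compression_le (m : nat) (W : 'M[R[i]]_(N, m)) :
  \det (W^t* *m P *m W) <= (\prod_(k < m) d k)%:C * \det (W^t* *m W).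
Proof.
have [Uu PE d0 dN _] := PUd.
pose z (t : 'I_N) k := (U *m W) t k.
have -> : W^t* *m P *m W = wgram (fun t : 'I_N => (d t)%:C) z.
  rewrite PE !mulmxA -trmxC_mul -!mulmxA /z; move: (U *m W) => Z.
  apply/matrixP => i j; rewrite !mxE; apply: eq_bigr => t _.
  by rewrite mul_diag_mx !mxE mulrCA.
have -> : W^t* *m W = wgram (fun=> 1) z.
  have -> : W^t* *m W = (U *m W)^t* *m (U *m W).
    by rewrite trmxC_mul mulmxA mulmxKtV.
  rewrite /z; move: (U *m W) => Z.
  by apply/matrixP => i j; rewrite !mxE; apply: eq_bigr => t _; rewrite !mxE mul1r.
apply: det_wgram_le => f finj; rewrite -rmorph_prod /= lecR.
by apply: (@ler_prod_injective _ d m (fun i => val (f i))) => // i j /val_inj/finj.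
Qed.

End Spectrum.

Lemma compression_rank1_sum (R : realType) (T : finType) (M N m : nat)
    (e : T -> R[i]) (x : T -> 'rV[R[i]]_M) (y : T -> 'rV[R[i]]_N)
    (W : 'M_(M, m)) (Z : 'M_(N, m)) :
  W^t* *m rank1_sum e x y *m Z
  = \matrix_(i, j) \sum_t e t * (Num.conj ((x t *m W) 0 i) * (y t *m Z) 0 j).
Proof.
by rewrite mul_rank1_sum trmxCK; apply/matrixP => i j; rewrite rank1_sumE mxE.
Qed.

Lemma det_rank1_sum_CauchySchwarz (R : realType) (T : finType) (M N m : nat)
    (e : T -> R[i]) (x : T -> 'rV[R[i]]_M) (y : T -> 'rV[R[i]]_N)
    (W : 'M_(M, m)) (Z : 'M_(N, m)) :
  `|\det (W^t* *m rank1_sum e x y *m Z)| ^+ 2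
  <= \det (W^t* *m rank1_sum (fun t => `|e t|) x x *m W)
     * \det (Z^t* *m rank1_sum (fun t => `|e t|) y y *m Z).
Proof.
rewrite !compression_rank1_sum; exact: det_wgram_CauchySchwarz.
Qed.

(** Let the columns of [Z] be the first [m] eigenvectors of [X^* X] and let [W = X Z]. Then
    [W^* X Z = W^* W] has determinant [prod a]. Cauchy-Schwarz bounds its square by two compressed
    determinants, at most [prod r * prod a] and [prod c]; a factor [prod a] cancels unless it is
    zero. *)
Lemma horn_rank1_sum (R : realType) (T : finType) (M N : nat)
    (e : T -> R[i]) (x : T -> 'rV[R[i]]_M) (y : T -> 'rV[R[i]]_N)
    (V : 'M_N) (a : nat -> R) (P : 'M_M) (r : nat -> R) (Q : 'M_N) (c : nat -> R) (m : nat) :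
  sorted_spectrum ((rank1_sum e x y)^t* *m rank1_sum e x y) V a ->
  sorted_spectrum (rank1_sum (fun t => `|e t|) x x) P r ->
  sorted_spectrum (rank1_sum (fun t => `|e t|) y y) Q c ->
  (m <= N)%N ->
  \prod_(k < m) a k <= (\prod_(k < m) r k) * \prod_(k < m) c k.
Proof.
set X := rank1_sum e x y; move=> XVa Pr Qc mN.
have [Vu XE a0 _ _] := XVa.
pose w := widen_ord mN; pose Z := (rowsub w V)^t*.
have subE P' : Z^t* *m P' *m Z = mxsub w w (V *m P' *m V^t*).
  have ZtE : Z^t* = rowsub w V by rewrite /Z trmxCK.
  have ZE : Z = colsub w (V^t*) by apply/matrixP => i j; rewrite !mxE.
  by rewrite mxsub_mul -mul_rowsub_mx ZtE ZE.
have ZZ : Z^t* *m Z = 1%:M.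
  rewrite -[Z^t*]mulmx1 subE mulmx1 (unitarymxP Vu).
  by apply/matrixP => i j; rewrite !mxE.
have WW : (X *m Z)^t* *m (X *m Z) = diag_mx (\row_(k < m) (a k)%:C).
  rewrite trmxC_mul mulmxA -[_ *m _ *m X]mulmxA subE (sorted_spectrum_diag XVa).
  by apply/matrixP => i j; rewrite !mxE.
have det_WW : \det ((X *m Z)^t* *m (X *m Z)) = (\prod_(k < m) a k)%:C.
  by rewrite WW det_diag rmorph_prod; apply: eq_bigr => k _; rewrite mxE.
have pa0 : 0 <= \prod_(k < m) a k by rewrite prodr_ge0.
have pc0 : 0 <= \prod_(k < m) c k by case: Qc => _ _ c0 _ _; rewrite prodr_ge0.
have pr0 : 0 <= \prod_(k < m) r k by case: Pr => _ _ r0 _ _; rewrite prodr_ge0.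
have := det_rank1_sum_CauchySchwarz e x y (X *m Z) Z; rewrite -/X.
rewrite -mulmxA det_WW ger0_norm ?ler0c //.
have := det_compression_le Pr (X *m Z); rewrite det_WW -rmorphM /= => le_r.
have := det_compression_le Qc Z; rewrite ZZ det1 mulr1 => le_c.
have : 0 <= \det (Z^t* *m rank1_sum (fun t => `|e t|) y y *m Z).
  by rewrite compression_rank1_sum; apply: det_wgram_ge0.
move=> dc0 /le_trans le_a.
have {le_a} : (\prod_(k < m) a k)%:C ^+ 2
    <= ((\prod_(k < m) r k) * \prod_(k < m) a k)%:C * (\prod_(k < m) c k)%:C.
  apply: le_a; apply: le_trans (ler_wpM2r dc0 le_r) _.
  by rewrite ler_wpM2l ?ler0c ?mulr_ge0.
rewrite -rmorphXn -rmorphM /= lecR => le_a.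
move: pa0; rewrite le_eqVlt => /orP[/eqP<-|pa0]; first by rewrite mulr_ge0.
by rewrite -(ler_pM2l pa0) -expr2 (le_trans le_a) // mulrCA mulrA lexx.
Qed.

(** * Block matrices *)

(** Right multiplication by it places a row of length [n] in block [j]. *)
Definition block_emb (C : numClosedFieldType) (q n : nat) (j : 'I_q) : 'M[C]_(n, \sum_(k < q) n) :=
  \mxrow_k (if k == j then 1%:M else 0 : 'M[C]_n).

Section BlockEmb.
Variables (C : numClosedFieldType) (n : nat).

Lemma trmxC_block_emb q (j : 'I_q) :
  (block_emb C n j)^t* = \mxcol_k (if k == j then 1%:M else 0 : 'M[C]_n).
Proof.
apply/matrixP => k l; rewrite !mxE; case: ifP => _; rewrite !mxE ?rmorph0 //.
by rewrite rmorph_nat eq_sym.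
Qed.

Lemma block_emb_mul q (i j : 'I_q) :
  block_emb C n i *m (block_emb C n j)^t* = if i == j then 1%:M else 0.
Proof.
rewrite trmxC_block_emb mul_mxrow_mxcol (bigD1 i) //= eqxx mul1mx big1 ?addr0 //.
by move=> k /negPf->; rewrite mul0mx.
Qed.

Lemma mxblock_block_emb p q (A : 'I_p -> 'I_q -> 'M[C]_n) :
  \mxblock_(i, j) A i j
  = \sum_i \sum_j (block_emb C n i)^t* *m A i j *m block_emb C n j.
Proof.
have E i j : (block_emb C n i)^t* *m A i j *m block_emb C n j
    = \mxblock_(k, l) (if k == i then if l == j then A k l else 0 else 0 : 'M[C]_n).
  rewrite trmxC_block_emb mxcol_mul mul_mxcol_mxrow; apply: eq_mxblock => k l.
  case: eqP => [->|_]; last by rewrite !mul0mx.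
  by case: eqP => [->|_]; rewrite mul1mx ?mulmx1 ?mulmx0.
transitivity (\sum_i \sum_j
    \mxblock_(k, l) (if k == i then if l == j then A k l else 0 else 0 : 'M[C]_n)); last first.
  by apply: eq_bigr => i _; apply: eq_bigr => j _; rewrite E.
under [RHS]eq_bigr do rewrite -mxblock_sum.
rewrite -mxblock_sum; apply: eq_mxblock => k l.
rewrite (bigD1 k) //= [X in _ + X]big1 => [|i ik]; last first.
  by rewrite big1 // => j _; rewrite eq_sym (negPf ik).
rewrite addr0 (bigD1 l) //= !eqxx big1 ?addr0 // => j jl.
by rewrite eq_sym (negPf jl).
Qed.

Lemma sum_block_emb q : \sum_(j < q) (block_emb C n j)^t* *m block_emb C n j = 1%:M.
Proof.
have <- : \mxblock_(i < q, j < q) (if i == j then 1%:M else 0 : 'M[C]_n) = 1%:M.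
  rewrite -(mxdiagZ (p_ := fun=> n)); apply: eq_mxblock => i j.
  by case: eqP => [_|//]; rewrite conform_mx_id.
rewrite mxblock_block_emb; apply: eq_bigr => i _.
rewrite [RHS](bigD1 i) //= eqxx mulmx1 [X in _ + X]big1 ?addr0 // => j ij.
by rewrite eq_sym (negPf ij) mulmx0 mul0mx.
Qed.

Lemma block_emb_unit q (v : 'rV[C]_n) (i : 'I_q) : v *m v^t* = 1%:M ->
  (v *m block_emb C n i) *m (v *m block_emb C n i)^t* = 1%:M.
Proof.
by move=> v1; rewrite trmxC_mul mulmxA -(mulmxA v) block_emb_mul eqxx mulmx1.
Qed.

End BlockEmb.

Lemma padmxE (R : realType) (q n : nat) (hq : (0 < q)%N) (Y : 'M[R[i]]_n) :
  padmx q Y = (block_emb _ n (Ordinal hq))^t* *m Y *m block_emb _ n (Ordinal hq).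
Proof.
rewrite /padmx mxblock_block_emb [LHS](bigD1 (Ordinal hq)) //=.
rewrite [X in X + _](bigD1 (Ordinal hq)) //=.
rewrite [X in _ + X]big1 ?addr0 => [|i i0]; last first.
  rewrite [LHS]big1 // => j _; case: eqP => [/= e|_ /=]; last by rewrite mulmx0 mul0mx.
  by case/negP: i0; apply/eqP/val_inj.
rewrite [X in _ + X]big1 ?addr0 // => i i0.
case: eqP => [/= e|_ /=]; last by rewrite mulmx0 mul0mx.
by case/negP: i0; apply/eqP/val_inj.
Qed.

Lemma rank1_sum_diag (R : realType) (N : nat) (U : 'M[R[i]]_N) (e : 'I_N -> R[i]) :
  rank1_sum e (fun k => row k U) (fun k => row k U) = U^t* *m diag_mx (\row_k e k) *m U.
Proof.
apply/matrixP => i j; rewrite rank1_sumE -mulmxA mxE.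
by apply: eq_bigr => k _; rewrite mul_diag_mx !mxE mulrCA.
Qed.

Lemma sorted_spectrum_rows (R : realType) (N : nat) (P U : 'M[R[i]]_N) (d : nat -> R) :
  sorted_spectrum P U d ->
  P = rank1_sum (fun k : 'I_N => (d k)%:C) (fun k => row k U) (fun k => row k U).
Proof. by case=> _ PE _ _ _; rewrite rank1_sum_diag. Qed.

Lemma row_unitary_unit (C : numClosedFieldType) (m n : nat) (U : 'M[C]_(m, n)) (k : 'I_m) :
  U \is unitarymx -> row k U *m (row k U)^t* = 1%:M.
Proof.
move=> /row_unitarymxP/(_ k k); rewrite dotmxE eqxx => kE.
by apply/matrixP => i j; rewrite !ord1 kE mxE.
Qed.

Lemma unit_row_sqn (R : realType) (N : nat) (y : 'rV[R[i]]_N) :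
  y *m y^t* = 1%:M -> \sum_k sqn (y 0 k) = 1.
Proof.
move=> /matrixP/(_ 0 0); rewrite !mxE eqxx => E; apply: complexI; rewrite -[RHS]E rmorph_sum.
by apply: eq_bigr => k _; rewrite /= !mxE sqnE mulrC.
Qed.

Lemma mulmx_unitary_unit (C : numClosedFieldType) (N : nat) (y : 'rV[C]_N) (U : 'M[C]_N) :
  U \is unitarymx -> y *m y^t* = 1%:M -> (y *m U^t*) *m (y *m U^t*)^t* = 1%:M.
Proof.
by move=> Uu y1; rewrite trmxC_mul trmxCK !mulmxA mulmxKtV.
Qed.

Lemma sum_ord_trunc (R : nmodType) (N m : nat) (F : nat -> R) :
  (forall k, (N <= k)%N -> F k = 0) ->
  \sum_(k < m) F k = \sum_(k < N | (k < m)%N) F k.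
Proof.
move=> F0; rewrite -(big_mkord (fun k => (k < m)%N)) -(big_mkord xpredT).
have [mN|Nm] := leqP m N.
  by rewrite (big_nat_widen _ _ _ _ _ mN).
rewrite (big_cat_nat (leq0n N) (ltnW Nm)) /= [X in _ + X]big_nat_cond [X in _ + X]big1 ?addr0.
  rewrite [LHS]big_nat_cond [RHS]big_nat_cond; apply: eq_bigl => k; lia.
by move=> k /andP[/andP[Nk _] _]; exact: F0.
Qed.

Lemma rank1_sum_pair (R : realType) (I J : finType) (M N : nat) (e : I * J -> R[i])
    (x : I * J -> 'rV[R[i]]_M) (y : I * J -> 'rV[R[i]]_N) :
  rank1_sum e x y
  = \sum_i rank1_sum (fun j => e (i, j)) (fun j => x (i, j)) (fun j => y (i, j)).
Proof. by rewrite /rank1_sum pair_bigA /=; apply: eq_bigr => -[]. Qed.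

Lemma rank1_sum_rows (R : realType) (N : nat) (U : 'M[R[i]]_N) :
  rank1_sum (fun=> 1) (fun k => row k U) (fun k => row k U) = U^t* *m U.
Proof.
apply/matrixP => i j; rewrite rank1_sumE mxE.
by apply: eq_bigr => k _; rewrite !mxE mul1r.
Qed.

(** Each [e_i w_i] is [h w_i + (e_i - h) w_i], and a weight in [0, 1] keeps the last product below
    the positive part. *)
Lemma max_sub_sum_le (R : realFieldType) (I : finType) (e w : I -> R) (h : R) :
  (forall i, 0 <= w i) -> (forall i, w i <= 1) ->
  \sum_i e i * w i <= h * (\sum_i w i) + \sum_i Num.max (e i - h) 0.
Proof.
move=> w0 w1; rewrite mulr_sumr -big_split /=; apply: ler_sum => i _.
rewrite -lerBlDl -mulrBl; have [eh|he] := leP (e i - h) 0.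
  exact: mulr_le0_ge0.
by rewrite ler_piMr // ltW.
Qed.

(** * Concave functions of a block diagonal sum *)

Section BlockDiagonal.
Variables (R : realType) (T : finType) (q n : nat).
Variables (j : T -> 'I_q) (b : T -> 'rV[R[i]]_n) (c : T -> R) (g : R -> R).
Hypothesis c_ge0 : forall t, 0 <= c t.
Hypothesis b_unit : forall t, b t *m (b t)^t* = 1%:M.
Hypothesis g_ge0 : forall x, 0 <= x -> 0 <= g x.
Hypothesis g_concave : concave_nneg g.
Hypothesis g0 : g 0 = 0.

Let y t := b t *m block_emb _ n (j t).

(** The frame inequality passes from [g (d k)] to diagonal entries of [sum g(c_t) y_t^* y_t] in the
    basis [U], which [max_sub_sum_le] bounds by the eigenvalues of the blocks. Superadditivity then
    merges the blocks into one [n x n] matrix. Keeping [h] free expresses weak majorization in dual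
    form. *)
Lemma block_diagonal_concave_sum (U : 'M_(\sum_(i < q) n)) (d : nat -> R)
    (W : 'M_n) (s : nat -> R) (m : nat) (h : R) :
  sorted_spectrum (rank1_sum (fun t => (c t)%:C) y y) U d ->
  sorted_spectrum (rank1_sum (fun t => (g (c t))%:C) b b) W s ->
  0 <= h ->
  \sum_(k < m) g (d k) <= h *+ m + \sum_(l < n) Num.max (s l - h) 0.
Proof.
set N := (\sum_(i < q) n)%N in U *; move=> CUd SWs h0.
have [Uu _ d0 dN d_out] := CUd.
(* [p i] keeps the terms of block [i]. Diagonalizing the blocks separately gives eigenvalues [e] and
   unit vectors [w]; [v] is [w] placed in its block. *)
pose p i t := if j t == i then g (c t) else 0.
have p0 i t : 0 <= p i t by rewrite /p; case: ifP => // _; exact: g_ge0.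
have /choice[V /choice[a Va]] (i : 'I_q) := rank1_sum_sorted_spectrum b (p0 i).
pose w (il : 'I_q * 'I_n) := row il.2 (V il.1).
pose e (il : 'I_q * 'I_n) := a il.1 il.2.
have e0 il : 0 <= e il by case: (Va il.1) => _ _ + _ _; exact.
have w1 il : w il *m (w il)^t* = 1%:M.
  by case: (Va il.1) => Vu _ _ _ _; exact: row_unitary_unit.
have rowsV i : rank1_sum (fun t => (p i t)%:C) b b
    = rank1_sum (fun l : 'I_n => (a i l)%:C) (fun l => row l (V i)) (fun l => row l (V i)).
  exact: sorted_spectrum_rows (Va i).
have S_pairs : rank1_sum (fun t => (g (c t))%:C) b b = rank1_sum (fun il => (e il)%:C) w w.
  transitivity (\sum_i rank1_sum (fun t => (p i t)%:C) b b); last first.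
    by rewrite rank1_sum_pair; apply: eq_bigr => i _; rewrite rowsV.
  rewrite exchange_big /=; apply: eq_bigr => t _.
  rewrite (bigD1 (j t)) //= /p eqxx big1 ?addr0 // => i /negPf ij.
  by rewrite eq_sym ij scale0r.
pose v il := w il *m block_emb _ n il.1.
have D_pairs : rank1_sum (fun t => (g (c t))%:C) y y = rank1_sum (fun il => (e il)%:C) v v.
  transitivity (\sum_i (block_emb _ n i)^t* *m rank1_sum (fun t => (p i t)%:C) b b
                         *m block_emb _ n i); last first.
    by rewrite rank1_sum_pair; apply: eq_bigr => i _; rewrite rowsV mul_rank1_sum trmxCK.
  under [RHS]eq_bigr do rewrite mul_rank1_sum trmxCK.
  rewrite exchange_big /=; apply: eq_bigr => t _.
  rewrite [RHS](bigD1 (j t)) //= /p eqxx [X in _ + X]big1 ?addr0 // => i /negPf ij.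
  by rewrite eq_sym ij scale0r.
have v_basis : rank1_sum (fun=> (1 : R)%:C) v v = 1%:M.
  rewrite rank1_sum_pair -(sum_block_emb _ n q); apply: eq_bigr => i _.
  have [Vu _ _ _ _] := Va i.
  have := mul_rank1_sum (fun=> 1) (fun l => row l (V i)) (fun l => row l (V i))
     ((block_emb _ n i)^t*) (block_emb _ n i).
  by rewrite rank1_sum_rows (unitarymx_tK Vu) mulmx1 trmxCK => ->.
(* Squared coordinates of one orthonormal basis in another: the sums over [il] and over [k] are both
   1. *)
pose o (il : 'I_q * 'I_n) k := sqn ((v il *m U^t*) 0 k).
have oE (f : 'I_q * 'I_n -> R) k : (\sum_il f il * o il k)%:C
    = (U *m rank1_sum (fun il => (f il)%:C) v v *m U^t*) k k.
  by rewrite mul_rank1_sum diag_rank1_sum.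
have o_sum k : \sum_il o il k = 1.
  apply: complexI; have := oE (fun=> 1) k; rewrite v_basis mulmx1 (unitarymxP Uu) mxE eqxx.
  by under eq_bigr do rewrite mul1r.
have v1 il : \sum_k o il k = 1.
  by apply: unit_row_sqn; apply: mulmx_unitary_unit => //; exact: block_emb_unit.
rewrite (@sum_ord_trunc _ N m (fun k => g (d k))) => [|k Nk]; last by rewrite d_out.
have := @concave_frame_sum R T N c (fun t k => (y t *m U^t*) 0 k) d c_ge0 d0
  (fun k l => sorted_spectrum_rank1 CUd k l erefl)
  (fun t => unit_row_sqn (mulmx_unitary_unit Uu (block_emb_unit _ (b_unit t))))
  g m g_ge0 g_concave g0 dN.
move=> /le_trans; apply.
under eq_bigr do rewrite mulr_sumr.
rewrite exchange_big /=.
have -> : \sum_(k < N | (k < m)%N) \sum_t g (c t) * sqn ((y t *m U^t*) 0 k)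
    = \sum_il e il * \sum_(k < N | (k < m)%N) o il k.
  under [RHS]eq_bigr do rewrite mulr_sumr.
  rewrite [RHS]exchange_big /=; apply: eq_bigr => k _; apply: complexI.
  by rewrite oE -D_pairs mul_rank1_sum diag_rank1_sum.
apply: le_trans (max_sub_sum_le _ h _ _) _ => [il|il|].
- by apply: sumr_ge0 => k _; exact: sqn_ge0.
- rewrite -[leRHS](v1 il) [leRHS](bigID (fun k : 'I_N => (k < m)%N)) /= lerDl.
  by apply: sumr_ge0 => k _; exact: sqn_ge0.
apply: lerD.
  rewrite -mulr_natr ler_wpM2l // exchange_big /=.
  (* Writing 1 as the indicator of [k < N] extends the summand by zero beyond [N], so that the total
     weight is at most [m] even for [m > N]. *)
  under eq_bigr => k _ do rewrite o_sum -[1]/(true%:R) -(ltn_ord k).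
  rewrite -(@sum_ord_trunc _ N m (fun k => (k < N)%N%:R)); last first.
    by move=> k; rewrite leqNgt => /negPf->.
  rewrite -[m in leRHS]card_ord -sumr_const; apply: ler_sum => k _.
  by case: (k < N)%N; rewrite ?lexx ?ler01.
rewrite S_pairs in SWs.
have [Wu _ s0 _ _] := SWs.
exact: (@superadditive_frame_sum R _ n e (fun il k => (w il *m W^t*) 0 k) s e0 s0
  (fun k l => sorted_spectrum_rank1 SWs k l erefl)
  (fun il => unit_row_sqn (mulmx_unitary_unit Wu (w1 il)))).
Qed.

End BlockDiagonal.

(** * Weak majorization and symmetric norms *)

Section Gauge.
Variables (R : realType) (M : nat) (N : 'M[R[i]]_M -> R).
Hypothesis hN : symmetric_norm N.

(** The symmetric gauge function of [N]: convex, and invariant under permutations and sign changes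
    of the coordinates. *)
Definition gauge (x : 'I_M -> R) : R := N (diag_mx (\row_k (x k)%:C)).

Lemma eq_gauge x y : x =1 y -> gauge x = gauge y.
Proof.
by move=> xy; congr (N (diag_mx _)); apply/rowP => k; rewrite !mxE xy.
Qed.

Lemma gauge_convex (x y : 'I_M -> R) (u v : R) : 0 <= u -> 0 <= v ->
  gauge (fun k => u * x k + v * y k) <= u * gauge x + v * gauge y.
Proof.
move=> u0 v0; rewrite /gauge.
have -> : diag_mx (\row_k (u * x k + v * y k)%:C)
  = u%:C *: diag_mx (\row_k (x k)%:C) + v%:C *: diag_mx (\row_k (y k)%:C).
  by apply/matrixP => i j; rewrite !mxE !mulrnAr -mulrnDl -!rmorphM -rmorphD.
apply: le_trans (symnormD hN _ _) _; apply: lerD; rewrite -lecR (symnormZ hN);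
  by rewrite ger0_norm ?ler0c // -rmorphM.
Qed.

Lemma gauge_perm (p : 'S_M) x : gauge (fun k => x (p k)) = gauge x.
Proof.
rewrite -[RHS](symnorm_unitary hN _ (unitary_perm_mx _ p) (unitary_perm_mx _ p^-1)).
congr N; apply/matrixP => i j; rewrite -row_permE -col_permE.
by rewrite !mxE (inj_eq perm_inj).
Qed.

Lemma gauge_flip (k : 'I_M) x : gauge (fun i => if i == k then - x i else x i) = gauge x.
Proof.
pose F : 'M[R[i]]_M := diag_mx (\row_i (if i == k then -1 else 1)).
have Fu : F \is unitarymx.
  apply/unitarymxP; rewrite /F mul_diag_mx; apply/matrixP => i j; rewrite !mxE.
  rewrite [j == i]eq_sym; case: (i =P j) => [->|_] /=; last by rewrite mulr0n conjC0 mulr0.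
  by rewrite mulr1n; case: ifP => _; rewrite ?rmorphN rmorph1 ?mulrNN mulr1.
rewrite -[RHS](symnorm_unitary hN _ (unitary_perm_mx _ 1) Fu) perm_mx1 mul1mx.
congr N; rewrite mul_mx_diag; apply/matrixP => i j; rewrite !mxE.
case: (i =P j) => [->|_] /=; last by rewrite !mulr0n mul0r.
by rewrite !mulr1n; case: ifP => _; rewrite ?mulr1 // mulrN1 rmorphN.
Qed.

(** The shrunk vector is the mean of [x] and its sign flip at [k] with weights [(1 + a / x k) / 2]
    and [(1 - a / x k) / 2]. *)
Lemma gauge_shrink (k : 'I_M) (x : 'I_M -> R) (a : R) : 0 <= a <= x k ->
  gauge (fun i => if i == k then a else x i) <= gauge x.
Proof.
move=> /andP[a0 ax]; have := le_trans a0 ax; rewrite le_eqVlt => /orP[/eqP xk|xk].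
  rewrite le_eqVlt; apply/orP; left; apply/eqP/eq_gauge => i.
  by case: eqP => // ->; apply/le_anti; rewrite ax -xk.
pose u := (1 + a / x k) / 2; pose v := (1 - a / x k) / 2.
have ax0 : 0 <= a / x k by rewrite divr_ge0 // ltW.
have ax1 : a / x k <= 1 by rewrite ler_pdivrMr // mul1r.
have u0 : 0 <= u by rewrite /u; lra.
have v0 : 0 <= v by rewrite /v; lra.
have := gauge_convex x (fun i => if i == k then - x i else x i) u0 v0.
rewrite gauge_flip -mulrDl [u + v](_ : _ = 1) ?mul1r; last by rewrite /u /v; lra.
apply: le_trans; rewrite le_eqVlt; apply/orP; left; apply/eqP/eq_gauge => i.
rewrite /u /v; case: eqP => [->|_]; last by lra.
by field; rewrite gt_eqF.
Qed.

(** The new vector is the mean of [y] and [y] with [j] and [k] exchanged, the latter with weight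
    [t / (y j - y k)]. *)
Lemma gauge_transfer (j k : 'I_M) (y : 'I_M -> R) (t : R) : j != k ->
  0 <= t -> t < y j - y k ->
  gauge (fun i => if i == j then y j - t else if i == k then y k + t else y i)
  <= gauge y.
Proof.
move=> jk t0 tjk; pose v := t / (y j - y k).
have d0 : 0 < y j - y k by lra.
have v0 : 0 <= v by rewrite divr_ge0 // ltW.
have v1 : 0 <= 1 - v by rewrite subr_ge0 ler_pdivrMr // mul1r ltW.
have vE : v * (y j - y k) = t by rewrite divfK // gt_eqF.
have := gauge_convex y (fun i => y (tperm j k i)) v1 v0.
rewrite gauge_perm -mulrDl subrK mul1r; apply: le_trans.
rewrite le_eqVlt; apply/orP; left; apply/eqP/eq_gauge => i.
have [->|ij] := eqVneq i j; first by rewrite tpermL; lra.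
have [->|ik] := eqVneq i k; first by rewrite tpermR; lra.
by rewrite tpermD 1?eq_sym //; lra.
Qed.

(* Repeated transfers [y_j - t, y_k + t] bring [y] to [x], each one fixing a
   further coordinate; only [x] has to be sorted for the prefix inequalities to
   survive. *)
Lemma gauge_weak_majorization (x y : 'I_M -> R) :
  (forall k, 0 <= x k) -> (forall i k : 'I_M, (i <= k)%N -> x k <= x i) ->
  (forall m, \sum_(k < M | (k < m)%N) x k <= \sum_(k < M | (k < m)%N) y k) ->
  gauge x <= gauge y.
Proof.
move=> x0 xN; have [n] := ubnP #|[set i | x i != y i]|.
elim: n y => // n IH y; rewrite ltnS => cardn xy.
have fewer z (k : 'I_M) : (forall i, x i = y i -> x i = z i) -> x k != y k -> x k = z k ->
    (#|[set i | x i != z i]| < n)%N.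
  move=> yz xyk xzk; apply: leq_trans cardn; apply: proper_card.
  apply/properP; split.
    by apply/fintype.subsetP => i; rewrite !inE; apply: contra_neq; exact: yz.
  by exists k; rewrite !inE // xzk eqxx.
have [/existsP[k1 k1P]|] := boolP [exists k, y k < x k]; last first.
  rewrite negb_exists => /forallP le_xy.
  have {}le_xy i : x i <= y i by rewrite leNgt.
  have [/existsP[k lt_xy]|] := boolP [exists k, x k < y k]; last first.
    rewrite negb_exists => /forallP le_yx; rewrite le_eqVlt; apply/orP; left.
    by apply/eqP/eq_gauge => i; apply/le_anti; rewrite le_xy leNgt le_yx.
  apply: le_trans (@gauge_shrink k y (x k) _); last by rewrite x0 le_xy.
  apply: IH.
    apply: (fewer _ k) => [i xyi||]; last by rewrite eqxx.
      by case: eqP => [->|_].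
    by rewrite lt_eqF.
  by move=> m; apply: ler_sum => i _; case: eqP => [->|_].
case: (@arg_minnP _ k1 (fun k => y k < x k) (fun k : 'I_M => k : nat) k1P) => k ltk kmin {k1 k1P}.
have before (i : 'I_M) : (i < k)%N -> x i <= y i.
  by move=> ik; rewrite leNgt; apply/negP => /kmin; rewrite leqNgt ik.
(* As [k] is the first index with [y k < x k], the prefix inequality of length [k + 1] would fail
   unless some earlier [y j] exceeded [x j]. *)
have [j jk ltj] : exists2 j : 'I_M, (j < k)%N & x j < y j.
  have [/existsP[j /andP[]]|] := boolP [exists j : 'I_M, (j < k)%N && (x j < y j)].
    by exists j.
  rewrite negb_exists => /forallP nj; have := xy k.+1.
  have split_k (F : 'I_M -> R) :
      \sum_(i < M | (i < k.+1)%N) F i = F k + \sum_(i < M | (i < k)%N) F i.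
    rewrite (bigD1 k) //=; congr (_ + _); apply: eq_bigl => i.
    by rewrite ltnS ltn_neqAle andbC.
  rewrite !split_k leNgt => /negP[]; apply: ltr_leD => //.
  by apply: ler_sum => i ik; have := nj i; rewrite ik /= -leNgt.
(* The largest transfer that overshoots neither [x j] nor [x k]; it makes one of these two
   coordinates agree with [x]. *)
pose t := Num.min (y j - x j) (x k - y k).
pose z i := if i == j then y j - t else if i == k then y k + t else y i.
have t0 : 0 < t by rewrite lt_min !subr_gt0 ltj ltk.
have tj : t <= y j - x j by rewrite ge_min lexx.
have tk : t <= x k - y k by rewrite ge_min lexx orbT.
have njk : j != k by apply/eqP => e; rewrite e ltnn in jk.
have xkj : x k <= x j by apply: xN; exact: ltnW.
apply: (@le_trans _ _ (gauge z)); last first.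
  by apply: gauge_transfer => //; lra.
apply: IH.
  have zx i : x i = y i -> x i = z i.
    rewrite /z; case: eqP => [->|_]; first lra.
    by case: eqP => [->|//]; lra.
  have [tE|tE] : t = y j - x j \/ t = x k - y k.
    by rewrite /t; case: leP; [left|right].
  - by apply: (fewer _ j) => //; rewrite ?lt_eqF // /z eqxx; lra.
  - apply: (fewer _ k) => //; rewrite ?gt_eqF // /z eq_sym (negPf njk) eqxx; lra.
(* Prefixes not containing [k] still dominate [x] termwise; the others contain both [j] and [k], so
   their sums are unchanged. *)
move=> m; have [mk|km] := leqP m k.
  apply: ler_sum => i im; rewrite /z; case: eqP => [->|_]; first lra.
  case: eqP => [ik|_]; last by apply: before; exact: leq_trans mk.
  by move: im; rewrite ik ltnNge mk.
rewrite (le_trans (xy m)) // le_eqVlt; apply/orP; left; apply/eqP.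
have jm : (j < m)%N by exact: ltn_trans km.
have kj_m : (k < m)%N && (k != j) by rewrite km eq_sym.
rewrite (bigD1 j) // (bigD1 k) //= [RHS](bigD1 j) // [X in _ = _ + X](bigD1 k) //=.
rewrite /z eqxx eq_sym (negPf njk) eqxx.
rewrite [X in _ = _ + (_ + X)](eq_bigr y); first by lra.
by move=> i /andP[/andP[_ /negPf->] /negPf->].
Qed.

End Gauge.

(** * Functions of absolute values; the theorem *)

Lemma rank1_sum_normal (R : realType) (N : nat) (A : 'M[R[i]]_N) : A \is normalmx ->
  A = rank1_sum (fun k => spectral_diag A 0 k) (fun k => row k (spectralmx A))
        (fun k => row k (spectralmx A)).
Proof.
move=> An; have Vu := spectral_unitarymx A; have /orthomx_spectralP AE := An.
rewrite rank1_sum_diag [\row__ _](_ : _ = spectral_diag A); last first.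
  by apply/rowP => k; rewrite mxE.
by rewrite -(invmx_unitary Vu).
Qed.

Lemma mxfun_absmx (R : realType) (f : R -> R) (m N : nat) (A : 'M[R[i]]_(m, N))
    (U : 'M_N) (d : 'I_N -> R) :
  U \is unitarymx -> A^t* *m A = U^t* *m diag_mx (\row_k (d k)%:C) *m U ->
  mxfun f (absmx A) = U^t* *m diag_mx (\row_k (f (Num.sqrt (d k)))%:C) *m U.
Proof.
move=> Uu AE.
have funE (h : R -> R) (v : 'I_N -> R) :
    mxfun h (U^t* *m diag_mx (\row_k (v k)%:C) *m U)
    = U^t* *m diag_mx (\row_k (h (v k))%:C) *m U.
  have := mxfunE h (\row_k v k) Uu; rewrite (invmx_unitary Uu).
  have rowE (e : R -> R) (w : 'I_N -> R) :
      map_mx (fun x => (e x)%:C) (\row_k w k) = \row_k (e (w k))%:C :> 'rV[R[i]]_N.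
    by apply/rowP => k; rewrite !mxE.
  by rewrite (rowE id) rowE.
by rewrite /absmx AE funE; exact: funE.
Qed.

Lemma trmxC_mul_diag (C : numClosedFieldType) (N : nat) (U : 'M[C]_N) (z : 'rV[C]_N) :
  U \is unitarymx ->
  (U^t* *m diag_mx z *m U)^t* *m (U^t* *m diag_mx z *m U)
  = U^t* *m diag_mx (\row_k `|z 0 k| ^+ 2) *m U.
Proof.
move=> Uu; rewrite !trmxC_mul trmxCK !mulmxA (mulmxtVK _ Uu).
congr (_ *m _); rewrite -mulmxA; congr (_ *m _).
rewrite mul_mx_diag; apply/matrixP => i j; rewrite !mxE normCK.
have [->|_] /= := eqVneq i j; first by rewrite !mulr1n mulrC.
by rewrite !mulr0n conjC0 mul0r.
Qed.

(** For normal [A] an eigenbasis of [A] also diagonalizes [A^* A], with eigenvalues [|z_k|^2]. *)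
Lemma mxfun_absmx_normal (R : realType) (f : R -> R) (N : nat) (A : 'M[R[i]]_N) :
  A \is normalmx ->
  mxfun f (absmx A)
  = rank1_sum (fun k => (f (complex.Re `|spectral_diag A 0 k|))%:C)
      (fun k => row k (spectralmx A)) (fun k => row k (spectralmx A)).
Proof.
move=> An; set V := spectralmx A; set z := spectral_diag A.
have Vu : V \is unitarymx by exact: spectral_unitarymx.
have AE : A = V^t* *m diag_mx z *m V.
  by rewrite -(invmx_unitary Vu); have /orthomx_spectralP := An.
have rE : \row_k (f (complex.Re `|z 0 k|))%:C
    = \row_k (f (Num.sqrt (complex.Re `|z 0 k| ^+ 2)))%:C :> 'rV[R[i]]_N.
  have z0 k : 0 <= complex.Re `|z 0 k| by rewrite -ler0c RRe_real ?normr_real.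
  by apply/rowP => k; rewrite !mxE sqrtr_sqr (ger0_norm (z0 k)).
rewrite rank1_sum_diag rE; apply: (mxfun_absmx f Vu).
have -> : \row_k (complex.Re `|z 0 k| ^+ 2)%:C = \row_k `|z 0 k| ^+ 2 :> 'rV[R[i]]_N.
  by apply/rowP => k; rewrite [LHS]mxE [RHS]mxE rmorphXn.
by have := trmxC_mul_diag z Vu; rewrite -AE.
Qed.

Lemma sig1_eq0 (q n : nat) (k : 'I_(\sum_(j < q) n)) :
  (tagnat.sig1 k == 0 :> nat) = (k < n)%N.
Proof.
rewrite (tagnat.rect k) /=; case: eqP => [k0|/eqP k0].
  by rewrite k0 big_pred0 // add0n ltn_ord.
apply/esym/negbTE; rewrite -leqNgt.
have q0 : (0 < q)%N by apply: leq_ltn_trans (ltn_ord (tagnat.sig1 k)).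
rewrite (bigD1 (Ordinal q0)) /= ?lt0n //; lia.
Qed.

Lemma sig2_val (q n : nat) (k : 'I_(\sum_(j < q) n)) : (k < n)%N ->
  tagnat.sig2 k = k :> nat.
Proof.
by rewrite -sig1_eq0 => /eqP k0; rewrite [RHS]tagnat.rect k0 big_pred0.
Qed.

Lemma padmx_diag (R : realType) (q n : nat) (v : nat -> R) :
  padmx q (diag_mx (\row_(k < n) (v k)%:C))
  = diag_mx (\row_k (if (k < n)%N then v k else 0)%:C).
Proof.
apply/matrixP => k l; rewrite !mxE !sig1_eq0.
have [kn|nk] /= := ltnP k n; last by rewrite mxE mul0rn.
have [ln|nl] /= := ltnP l n; last first.
  rewrite mxE (_ : (k == l) = false) ?mulr0n //.
  by apply/negbTE/eqP => kl; move: nl; rewrite -kl leqNgt kn.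
rewrite !mxE sig2_val //; congr (_ *+ _).
by rewrite -!val_eqE /= !sig2_val.
Qed.

Lemma trmxC_sum (C : numClosedFieldType) (I : finType) (m n : nat)
    (F : I -> 'M[C]_(m, n)) : (\sum_i F i)^t* = \sum_i (F i)^t*.
Proof.
apply/matrixP => i j; rewrite !mxE !summxE rmorph_sum.
by apply: eq_bigr => k _; rewrite !mxE.
Qed.

(** The block diagonal matrix [W] with [U] in all [q] blocks is unitary, and conjugating the padded
    [D] by it pads [U^* D U]. *)
Lemma padmx_unitary (R : realType) (q n : nat) (N : 'M[R[i]]_(\sum_(j < q) n) -> R)
    (U D : 'M[R[i]]_n) : (0 < q)%N -> symmetric_norm N -> U \is unitarymx ->
  N (padmx q (U^t* *m D *m U)) = N (padmx q D).
Proof.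
move=> q0 hN Uu; pose E j := block_emb R[i] n (j : 'I_q).
pose W := \sum_j (E j)^t* *m U *m E j.
have EW j : E j *m W = U *m E j.
  rewrite mulmx_sumr [LHS](bigD1 j) //= [X in _ + X]big1 ?addr0 => [|i ij].
    by rewrite !mulmxA block_emb_mul eqxx mul1mx.
  by rewrite !mulmxA block_emb_mul eq_sym (negPf ij) !mul0mx.
have WE j : W *m (E j)^t* = (E j)^t* *m U.
  rewrite mulmx_suml [LHS](bigD1 j) //= [X in _ + X]big1 ?addr0 => [|i ij].
    by rewrite -!mulmxA block_emb_mul eqxx mulmx1.
  by rewrite -!mulmxA block_emb_mul (negPf ij) !mulmx0.
have Wu : W \is unitarymx.
  apply/unitarymxP.
  have WtE : W^t* = \sum_j (E j)^t* *m U^t* *m E j.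
    by rewrite trmxC_sum; apply: eq_bigr => j _; rewrite !trmxC_mul trmxCK mulmxA.
  rewrite WtE mulmx_sumr -(sum_block_emb _ n q); apply: eq_bigr => j _.
  by rewrite !mulmxA WE mulmxtVK.
have Wtu : W^t* \is unitarymx by rewrite trmxC_unitary.
have EtW j : W^t* *m (E j)^t* = (E j)^t* *m U^t* by rewrite -trmxC_mul EW trmxC_mul.
rewrite -[RHS](symnorm_unitary hN _ Wtu Wu) !(padmxE q0) -/(E (Ordinal q0)).
by rewrite 2![in RHS]mulmxA EtW -[in RHS](mulmxA _ (E _)) EW !mulmxA.
Qed.

(** For [m <= n] take [h = s m], for which the bound on [L] is the sum of the first [m] values of
    [s]; for [m > n] take [h = 0]. The constant fits since [m <= p q m] in the first case and
    [m <= q n <= p q n] in the second. *)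
Lemma prefix_sum_bound (R : realFieldType) (s : nat -> R) (n p q m : nat) (r L : R) :
  (forall k, 0 <= s k) -> (forall k l, (k <= l)%N -> s l <= s k) ->
  (0 < p)%N -> (0 < q)%N -> (m <= q * n)%N -> 0 <= r ->
  (forall h, 0 <= h -> L <= h *+ m + \sum_(l < n) Num.max (s l - h) 0) ->
  r *+ m + L <= \sum_(k < m) (if (k < n)%N then s k + r *+ (p * q) else 0).
Proof.
move=> s0 sN p0 q0 mqn r0 HL; have [mn|nm] := leqP m n.
- apply: le_trans (lerD (lexx _) (HL (s m) (s0 m))) _.
  rewrite (@sum_ord_trunc _ m n (fun l => Num.max (s l - s m) 0)) => [|k mk]; last first.
    by apply/max_idPr; rewrite subr_le0 sN.
  have sum_const x : x *+ m = \sum_(k < m) x :> R by rewrite sumr_const card_ord.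
  rewrite !sum_const.
  rewrite [X in _ + (_ + X)](eq_bigl xpredT) => [|k]; last exact: leq_trans mn.
  rewrite -!big_split; apply: ler_sum => k _ /=; rewrite (leq_trans _ mn) //.
  have /max_idPl-> : 0 <= s k - s m by rewrite subr_ge0 sN // ltnW.
  rewrite [s m + _]addrC subrK addrC lerD2l -[leLHS]mulr1n.
  by apply: ler_wpMn2l; rewrite // muln_gt0 p0.
- have := HL 0 (lexx 0); rewrite mul0rn add0r => /(lerD (lexx (r *+ m))) /le_trans; apply.
  rewrite (@sum_ord_trunc _ n m (fun k => if (k < n)%N then s k + r *+ (p * q) else 0));
    last by move=> k; rewrite leqNgt => /negPf->.
  rewrite [leRHS](eq_bigl xpredT) => [|k]; last exact: ltn_trans nm.
  rewrite [leRHS](eq_bigr (fun k : 'I_n => s k + r *+ (p * q))) => [|k _]; last by rewrite ltn_ord.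
  rewrite big_split /= sumr_const card_ord [leRHS]addrC; apply: lerD.
    rewrite -mulrnA; apply: ler_wpMn2l => //; apply: (leq_trans mqn).
    by rewrite -mulnA leq_pmull.
  by apply: ler_sum => k _; rewrite subr0 (max_idPl _).
Qed.

(** * Singular values of the block matrix *)

Section RankOneSingularValues.
Variables (R : realType) (T : finType) (p q n : nat).
Variables (z : T -> R[i]) (i : T -> 'I_p) (j : T -> 'I_q) (b : T -> 'rV[R[i]]_n).
Variables (g : R -> R) (V : 'M[R[i]]_(\sum_(j < q) n)) (a : nat -> R).
Variables (W : 'M[R[i]]_n) (s : nat -> R).
Hypothesis b_unit : forall t, b t *m (b t)^t* = 1%:M.
Hypothesis g_ge0 : forall x, 0 <= x -> 0 <= g x.
Hypothesis g_nd : forall x y, 0 <= x -> x <= y -> g x <= g y.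
Hypothesis g_concave : concave_nneg g.
Hypothesis g_econvex : e_convex g.
Hypothesis g0 : g 0 = 0.

Let X : 'M[R[i]]_(\sum_(i < p) n, \sum_(j < q) n) :=
  rank1_sum z (fun t => b t *m block_emb _ n (i t)) (fun t => b t *m block_emb _ n (j t)).

(** Horn's inequality and the Tomic-Weyl argument give the mean of two sums, over the row and the
    column block diagonal matrices. Both sums have the same bound, because forgetting the block
    positions leaves the same [n x n] matrix. *)
Lemma block_singular_values_sum (m : nat) (h : R) :
  sorted_spectrum (X^t* *m X) V a ->
  sorted_spectrum (rank1_sum (fun t => (g (complex.Re `|z t|))%:C) b b) W s ->
  (m <= \sum_(j < q) n)%N -> 0 <= h ->
  \sum_(k < m) g (Num.sqrt (a k)) <= h *+ m + \sum_(l < n) Num.max (s l - h) 0.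
Proof.
move=> Va Ws mM h0.
pose c t := complex.Re `|z t|.
have cE t : (c t)%:C = `|z t| by rewrite RRe_real ?normr_real.
have c0 t : 0 <= c t by rewrite -ler0c cE.
have zE M (y : T -> 'rV[R[i]]_M) :
    rank1_sum (fun t => `|z t|) y y = rank1_sum (fun t => (c t)%:C) y y.
  by apply: eq_bigr => t _; rewrite cE.
have [P [r Pr]] := rank1_sum_sorted_spectrum (fun t => b t *m block_emb _ n (i t)) c0.
have [Q [d Qd]] := rank1_sum_sorted_spectrum (fun t => b t *m block_emb _ n (j t)) c0.
have r_le := block_diagonal_concave_sum c0 b_unit g_ge0 g_concave g0 m Pr Ws h0.
have d_le := block_diagonal_concave_sum c0 b_unit g_ge0 g_concave g0 m Qd Ws h0.
rewrite -zE in Pr; rewrite -zE in Qd.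
have [_ _ a0 aN _] := Va; have [_ _ r0 _ _] := Pr; have [_ _ d0 _ _] := Qd.
have : \sum_(k < m) g (Num.sqrt (a k))
    <= (\sum_(k < m) g (r k) + \sum_(k < m) g (d k)) / 2.
  apply: (@e_convex_weak_log_majorization R g (fun k => Num.sqrt (a k))) => //.
  - by move=> k l kl; rewrite ler_sqrt ?aN.
  - move=> k km; under eq_bigr do rewrite sqr_sqrtr //.
    by apply: (horn_rank1_sum Va Pr Qd); exact: leq_trans mM.
by move=> /le_trans; apply; lra.
Qed.

End RankOneSingularValues.

Lemma rank1_sum_shift (R : realType) (N : nat) (W : 'M[R[i]]_N) (s : nat -> R) (r : R) :
  W \is unitarymx ->
  W^t* *m diag_mx (\row_k (s k)%:C) *m W + r%:C%:M
  = W^t* *m diag_mx (\row_k (s k + r)%:C) *m W.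
Proof.
move=> Wu.
have -> : r%:C%:M = W^t* *m r%:C%:M *m W.
  by rewrite -mulmxA mul_scalar_mx -scalemxAr (unitarymx_tK Wu) scalemx1.
rewrite -mulmxDl -mulmxDr -diag_const_mx -raddfD.
have -> // : \row_k (s k)%:C + const_mx r%:C = \row_k (s k + r)%:C :> 'rV[R[i]]_N.
by apply/rowP => k; rewrite !mxE -rmorphD.
Qed.

Lemma trmxC_mul_sorted_spectrum (R : realType) (M N : nat) (X : 'M[R[i]]_(M, N)) :
  exists V a, sorted_spectrum (X^t* *m X) V a.
Proof.
apply: psd_sorted_spectrum; first by rewrite trmxC_mul trmxCK.
move=> v.
have -> : v *m (X^t* *m X) *m v^t* = (X *m v^t*)^t* *m (X *m v^t*).
  by rewrite trmxC_mul trmxCK !mulmxA.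
rewrite mxE; apply: sumr_ge0 => k _; rewrite !mxE mulrC; exact: mul_conjC_ge0.
Qed.

Theorem theorem2p1 (R : realType) (p q n : nat)
    (hp : (0 < p)%N) (hq : (0 < q)%N) (hn : (0 < n)%N)
    (A : 'I_p -> 'I_q -> 'M[R[i]]_n)
    (hA : forall i j, A i j \is normalmx)
    (f : R -> R)
    (f_ge0 : forall x : R, 0 <= x -> 0 <= f x)
    (f_concave : concave_nneg f)
    (f_econvex : e_convex f)
    (N : 'M[R[i]]_(\sum_(j < q) n) -> R)
    (hN : symmetric_norm N) :
  N (mxfun f (absmx (\mxblock_(i < p, j < q) A i j)))
  <= N (padmx q (\sum_(i < p) \sum_(j < q) mxfun f (absmx (A i j)))).
Proof.
(* Subtracting [f 0] gives the normalization [g 0 = 0] used by the frame inequalities and by the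
   case of zero singular values. *)
pose g x := f x - f 0.
have f_nd := concave_nneg_nondecreasing f_ge0 f_concave.
have g_nd x y : 0 <= x -> x <= y -> g x <= g y.
  by move=> x0 xy; rewrite lerD2r f_nd.
have g0 : g 0 = 0 by rewrite /g subrr.
have g_ge0 x : 0 <= x -> 0 <= g x by move=> x0; rewrite subr_ge0 f_nd.
have g_concave : concave_nneg g by exact: concave_nneg_subr.
have g_econvex : e_convex g by exact: e_convex_subr.
pose T : finType := ('I_p * ('I_q * 'I_n))%type.
pose z (t : T) := spectral_diag (A t.1 t.2.1) 0 t.2.2.
pose b (t : T) := row t.2.2 (spectralmx (A t.1 t.2.1)).
have b_unit t : b t *m (b t)^t* = 1%:M.
  exact: row_unitary_unit (spectral_unitarymx _).
have XE : \mxblock_(i < p, j < q) A i j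
    = rank1_sum z (fun t => b t *m block_emb _ n t.1) (fun t => b t *m block_emb _ n t.2.1).
  rewrite mxblock_block_emb rank1_sum_pair; apply: eq_bigr => i _.
  rewrite rank1_sum_pair; apply: eq_bigr => j _.
  by rewrite {1}(rank1_sum_normal (hA i j)) mul_rank1_sum trmxCK.
(* Each of the [p q] blocks contributes an orthonormal basis, hence an identity matrix. This is how
   the constant [f 0] becomes the scalar matrix [f 0 * p q]. *)
have b_basis : rank1_sum (fun=> 1) b b = (p * q)%:R%:M.
  rewrite rank1_sum_pair (eq_bigr (fun=> (q%:R)%:M)) => [|i _].
    by rewrite sumr_const card_ord -raddfMn -mulrnA mulnC.
  rewrite rank1_sum_pair (eq_bigr (fun=> 1%:M)) => [|j _].
    by rewrite sumr_const card_ord -raddfMn.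
  exact: etrans (rank1_sum_rows _) (unitarymx_tK (spectral_unitarymx (A i j))).
have SfE : \sum_(i < p) \sum_(j < q) mxfun f (absmx (A i j))
    = rank1_sum (fun t => (g (complex.Re `|z t|))%:C) b b + (f 0 *+ (p * q))%:C%:M.
  transitivity (rank1_sum (fun t => (f (complex.Re `|z t|))%:C) b b).
    rewrite rank1_sum_pair; apply: eq_bigr => i _.
    rewrite rank1_sum_pair; apply: eq_bigr => j _.
    by rewrite (mxfun_absmx_normal _ (hA i j)).
  rewrite -[f 0 *+ _]mulr_natr rmorphM rmorph_nat -scale_scalar_mx -b_basis.
  rewrite scaler_sumr -big_split; apply: eq_bigr => t _ /=.
  by rewrite scale1r -scalerDl -rmorphD /g subrK.
have c0 t : 0 <= g (complex.Re `|z t|).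
  by apply: g_ge0; rewrite -ler0c RRe_real ?normr_real.
have [W [s Ws]] := rank1_sum_sorted_spectrum b c0.
have [Wu SgE s0 sN s_out] := Ws.
have [V [a Va]] := trmxC_mul_sorted_spectrum (\mxblock_(i < p, j < q) A i j).
have [Vu VE a0 aN a_out] := Va.
(* Both sides are reduced to norms of diagonal matrices: [f (sqrt a_k)] on the left,
   [s_k + f 0 * p q] padded by zeros on the right. *)
rewrite (@mxfun_absmx R f _ _ _ V a Vu VE).
rewrite SfE SgE (rank1_sum_shift s (f 0 *+ (p * q)) Wu) (padmx_unitary _ hq hN Wu)
  (padmx_diag q n (fun k => s k + f 0 *+ (p * q))).
have Vtu : V^t* \is unitarymx by rewrite trmxC_unitary.
rewrite (symnorm_unitary hN _ Vtu Vu).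
apply: (gauge_weak_majorization hN (x := fun k => f (Num.sqrt (a k)))
  (y := fun k => if (k < n)%N then s k + f 0 *+ (p * q) else 0)).
- by move=> k; rewrite f_ge0.
- by move=> k l kl; rewrite f_nd ?ler_sqrt ?aN.
move=> m0.
(* A prefix longer than the matrix is the whole sum. *)
wlog mM : m0 / (m0 <= \sum_(j < q) n)%N => [wl|].
  have [|Mm] := leqP m0 (\sum_(j < q) n)%N; first exact: wl.
  have full l (F : 'I_(\sum_(j < q) n) -> R) : (\sum_(j < q) n <= l)%N ->
      \sum_(k : 'I__ | (k < l)%N) F k = \sum_k F k.
    by move=> Ml; apply: eq_bigl => k; exact: leq_trans Ml.
  by have := wl _ (leqnn _); rewrite !full // ltnW.
rewrite -!(big_ord_widen _ (fun k => f (Num.sqrt (a k))) mM).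
rewrite -!(big_ord_widen _ (fun k => if (k < n)%N then s k + f 0 *+ (p * q) else 0) mM).
have -> : \sum_(k < m0) f (Num.sqrt (a k)) = f 0 *+ m0 + \sum_(k < m0) g (Num.sqrt (a k)).
  rewrite -[m0 in _ *+ m0]card_ord -sumr_const -big_split /=.
  by apply: eq_bigr => k _; rewrite /g addrC subrK.
apply: prefix_sum_bound => //.
- by move: mM; rewrite sum_nat_const card_ord.
- exact: f_ge0.
move=> h h0; rewrite XE in Va.
exact: (block_singular_values_sum b_unit g_ge0 g_nd g_concave g_econvex g0 Va Ws mM h0).
Qed.
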